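(* Assume that $f$ is convex (take $\mu=0$). Let $0<\eta\le1/L$ and run one step $x_0'=\mathrm{Prox}_{\eta\psi}[x_0-\eta g]$, where $g$ is a stochastic gradient estimate with $\mathbb E[g]=\nabla f(x_0)$ and $\mathbb E\|g-\nabla f(x_0)\|^2\le\sigma^2$. Use $x_0'$ as initial point of Algorithm (C) (see context) with constant step size $\eta_k=\eta$ and $\gamma_0=1/\eta$, with variances $\omega_k^2\le\sigma^2$ for all $k\ge1$. Then, after $K\geq 1$ iterations of Algorithm (C), $$\mathbb E[F(x_K)-F^\star]\le\frac{2\|x_0-x^\star\|^2}{(1+K)^2\eta}+\sigma^2\eta(K+1).$$ If in addition $\eta=\min\left(\frac1L,\sqrt{\frac{2\|x_0-x^\star\|^2}{\sigma^2}}\frac1{(K+1)^{3/2}}\right)$, then $$\mathbb E[F(x_K)-F^\star]\le\frac{2L\|x_0-x^\star\|^2}{(1+K)^2}+2\|x_0-x^\star\|\sigma\sqrt{\frac2{1+K}}.$$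
   Context: Problem: minimize $F=f+\psi$ on $\mathbb R^p$; $f$ is convex and $L$-smooth (differentiable with $L$-Lipschitz gradient); $\psi:\mathbb R^p\to\mathbb R\cup\{+\infty\}$ is proper convex lower semicontinuous; $x^\star$ is a minimizer of $F$, $F^\star=F(x^\star)$. $\mathrm{Prox}_{\eta\psi}[u]=\arg\min_x\{\eta\psi(x)+\frac12\|x-u\|^2\}$. Algorithm (C) with $\mu=0$: deterministic step sizes $0<\eta_k\le1/L$, parameter $\gamma_0>0$; sequences with $\delta_k=\sqrt{\eta_k\gamma_k}$ for $k\ge0$ and $\gamma_k=(1-\delta_k)\gamma_{k-1}$ for $k\ge1$. Starting from an initial point (here $x_0'$) taken as zeroth iterate of both the $x$- and $y$-sequences, for $k\ge1$ set $x_k=\mathrm{Prox}_{\eta_k\psi}[y_{k-1}-\eta_kg_k]$, where $\mathbb E[g_k\mid\mathcal F_{k-1}]=\nabla f(y_{k-1})$, $y_k=x_k+\beta_k(x_k-x_{k-1})$ with $\beta_k=\frac{\delta_k(1-\delta_k)\eta_{k+1}}{\eta_k\delta_{k+1}+\eta_{k+1}\delta_k^2}$. $\mathcal F_{k-1}$ is the filtration representing all information up to iteration $k-1$ (including the preliminary step), and $\omega_k^2=\mathbb E[\|\nabla f(y_{k-1})-g_k\|^2]$. If $\sigma=0$ the second argument of the minimum defining $\eta$ is $+\infty$. *)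

(* Defs.v *)
From HB Require Import structures.
From mathcomp Require Import all_boot all_order all_algebra.
From mathcomp Require Import all_classical all_reals all_analysis.

Set Implicit Arguments.
Unset Strict Implicit.
Unset Printing Implicit Defensive.

Import Order.TTheory GRing.Theory Num.Theory.
Import numFieldNormedType.Exports.

Local Open Scope classical_set_scope.
Local Open Scope ring_scope.

(* R^p is 'rV[R]_p.  The library's norm `|x| on 'rV[R]_p is
   the sup norm.  It induces the same topology, and hence the same notions of
   differentiability and lower semicontinuity, as the Euclidean norm [enorm]. *)
Definition enorm (R : realType) (p : nat) (u : 'rV[R]_p) : R :=
  Num.sqrt (\sum_(i < p) u ord0 i ^+ 2).

Definition grad (R : realType) (p : nat) (f : 'rV[R]_p -> R) (u : 'rV[R]_p) :
    'rV[R]_p :=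
  \row_(i < p) 'D_(delta_mx ord0 i) f u.

Definition smooth (R : realType) (p : nat) (L : R) (f : 'rV[R]_p -> R) : Prop :=
  (forall u, differentiable f u) /\
  (forall u v, enorm (grad f u - grad f v) <= L * enorm (u - v)).

(* Functions R^p -> R \cup {+oo} take values in \bar R; properness excludes
   the value -oo. *)
Definition proper_function (R : realType) (p : nat)
    (psi : 'rV[R]_p -> \bar R) : Prop :=
  (forall u, (-oo < psi u)%E) /\ (exists u, (psi u < +oo)%E).

Definition econvex_function (R : realType) (p : nat)
    (psi : 'rV[R]_p -> \bar R) : Prop :=
  forall (t : R) (u v : 'rV[R]_p), 0 <= t -> t <= 1 ->
    (psi (t *: u + (1 - t) *: v)%R <= t%:E * psi u + (1 - t)%:E * psi v)%E.

Definition argmin (R : realType) (V : Type) (phi : V -> \bar R) : set V :=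
  [set u | forall v, (phi u <= phi v)%E].

(* For psi proper, convex and lower semicontinuous and eta > 0 the argmin is a
   singleton, so that [xget] returns its unique element and the default value 0
   is never used. *)
Definition prox (R : realType) (p : nat) (psi : 'rV[R]_p -> \bar R) (eta : R)
    (u : 'rV[R]_p) : 'rV[R]_p :=
  xget 0 (argmin (fun z => eta%:E * psi z + (2^-1 * enorm (z - u) ^+ 2)%:E)%E).

Definition objective (R : realType) (p : nat) (f : 'rV[R]_p -> R)
    (psi : 'rV[R]_p -> \bar R) (u : 'rV[R]_p) : \bar R :=
  ((f u)%:E + psi u)%E.

Definition measurable_wrt (T : Type) (R : realType) (G : set (set T))
    (X : T -> R) : Prop :=
  forall B : set R, measurable B -> G (X @^-1` B).

Definition vec_measurable_wrt (T : Type) (R : realType) (p : nat)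
    (G : set (set T)) (X : T -> 'rV[R]_p) : Prop :=
  forall i : 'I_p, measurable_wrt G (fun w => X w ord0 i).

Definition filtration (d : measure_display) (T : measurableType d)
    (F : nat -> set (set T)) : Prop :=
  [/\ forall k, sigma_algebra setT (F k),
      forall k, F k `<=` @measurable d T &
      forall k, F k `<=` F k.+1].

Definition has_mean (d : measure_display) (T : measurableType d) (R : realType)
    (P : probability T R) (p : nat) (X : T -> 'rV[R]_p) (m : 'rV[R]_p) : Prop :=
  forall i : 'I_p,
    P.-integrable setT (fun w => (X w ord0 i)%:E) /\
    ('E_P[fun w => X w ord0 i] = (m ord0 i)%:E)%E.

(* [Y] is a version of the conditional expectation E[X | G]. *)
Definition is_cond_expectation (d : measure_display) (T : measurableType d)
    (R : realType) (P : probability T R) (p : nat) (G : set (set T))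
    (X Y : T -> 'rV[R]_p) : Prop :=
  vec_measurable_wrt G Y /\
  forall i : 'I_p,
    [/\ P.-integrable setT (fun w => (X w ord0 i)%:E),
        P.-integrable setT (fun w => (Y w ord0 i)%:E) &
        forall A, G A ->
          (\int[P]_(w in A) (X w ord0 i)%:E = \int[P]_(w in A) (Y w ord0 i)%:E)%E].

Definition mean_sq_error (d : measure_display) (T : measurableType d)
    (R : realType) (P : probability T R) (p : nat) (X Y : T -> 'rV[R]_p) :
    \bar R :=
  ('E_P[fun w => (enorm (X w - Y w) ^+ 2)%R])%E.

Definition extrapolation (R : realType) (eta delta : nat -> R) (k : nat) : R :=
  (delta k * (1 - delta k) * eta k.+1) /
  (eta k * delta k.+1 + eta k.+1 * delta k ^+ 2).

(* The accelerated stochastic proximal gradient method with mu = 0, run from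
   the (random) point [xinit].  [F k] is the information available after
   iteration k; the value [g 0] is not used. *)
Record algorithm_C (d : measure_display) (T : measurableType d) (R : realType)
    (P : probability T R) (p : nat) (L : R) (f : 'rV[R]_p -> R)
    (psi : 'rV[R]_p -> \bar R) (eta gamma delta : nat -> R)
    (F : nat -> set (set T)) (xinit : T -> 'rV[R]_p)
    (g x y : nat -> T -> 'rV[R]_p) : Prop := AlgorithmC {
  algC_eta : forall k, 0 < eta k <= L^-1;
  algC_gamma0 : 0 < gamma 0%N;
  algC_delta : forall k, delta k = Num.sqrt (eta k * gamma k);
  algC_gamma : forall k, gamma k.+1 = (1 - delta k.+1) * gamma k;
  algC_filtration : filtration F;
  algC_adapted : forall k, vec_measurable_wrt (F k.+1) (g k.+1);
  algC_unbiased : forall k,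
    is_cond_expectation P (F k) (g k.+1) (fun w => grad f (y k w));
  algC_x0 : forall w, x 0%N w = xinit w;
  algC_y0 : forall w, y 0%N w = xinit w;
  algC_x : forall k w,
    x k.+1 w = prox psi (eta k.+1) (y k w - eta k.+1 *: g k.+1 w);
  algC_y : forall k w,
    y k.+1 w = x k.+1 w
      + extrapolation eta delta k.+1 *: (x k.+1 w - x k w) }.

(* min (1/L) (sqrt (2 D^2 / sigma^2) / (K+1)^(3/2)), where the second argument
   is +oo when sigma = 0. *)
Definition tuned_stepsize (R : realType) (L D sigma : R) (K : nat) : R :=
  if sigma == 0 then L^-1
  else Num.min L^-1
         (Num.sqrt (2 * D ^+ 2 / sigma ^+ 2) * ((K.+1)%:R `^ (3 / 2))^-1).

(* Main.v *)
Require Import Defs.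
From HB Require Import structures.
From mathcomp Require Import all_boot all_order all_algebra.
From mathcomp Require Import all_classical all_reals all_analysis.
From mathcomp Require Import measurable_realfun ring lra.

Set Implicit Arguments.
Unset Strict Implicit.
Unset Printing Implicit Defensive.

Import Order.TTheory GRing.Theory Num.Theory.
Import numFieldNormedType.Exports HBNNSimple.

Local Open Scope classical_set_scope.
Local Open Scope ring_scope.

(* With t_k = 1 / delta_k the scheme is FISTA: t_0 = 1 and
   t_{k+1}^2 - t_{k+1} = t_k^2, so that t_k is nondecreasing and at least
   (k + 2) / 2.  Put z_k = delta_k x* + (1 - delta_k) x_{k-1}, let v_k be the
   point with x_k = (1 - delta_k) x_{k-1} + delta_k v_k, and let
   e_k = grad f (y_{k-1}) - g_k.  The proximal gradient inequality at z_k,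
   divided by delta_k^2, telescopes to
     t_n^2 (F x_n - F x* ) + |x* - v_n|^2 / (2 eta)
       <= |x* - x_0|^2 / (2 eta) + sum_{k <= n} t_k^2 <e_k, x_k - z_k>,
   where the preliminary step provides the term k = 0.  To bound the noise,
   compare x_k with the point xbar_k obtained from the exact gradient: the
   proximal map is nonexpansive, so <e_k, x_k - xbar_k> <= eta |e_k|^2, while
   xbar_k - z_k is F_{k-1}-measurable and square integrable, so that
   E <e_k, xbar_k - z_k> = 0. *)

(** * Euclidean geometry *)

Definition dotp {R : realType} {p : nat} (u v : 'rV[R]_p) : R :=
  \sum_(i < p) u ord0 i * v ord0 i.

Section Euclidean.
Context {R : realType} {p : nat}.
Implicit Types (u v w : 'rV[R]_p) (a : R).

Lemma dotpC u v : dotp u v = dotp v u.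
Proof. by apply: eq_bigr => i _; rewrite mulrC. Qed.

Lemma dotpDl u v w : dotp (u + v) w = dotp u w + dotp v w.
Proof. by rewrite -big_split; apply: eq_bigr => i _; rewrite mxE mulrDl. Qed.

Lemma dotpZl a u w : dotp (a *: u) w = a * dotp u w.
Proof. by rewrite mulr_sumr; apply: eq_bigr => i _; rewrite mxE mulrA. Qed.

Lemma dotpDr u v w : dotp w (u + v) = dotp w u + dotp w v.
Proof. by rewrite dotpC dotpDl !(dotpC w). Qed.

Lemma dotpZr a u w : dotp w (a *: u) = a * dotp w u.
Proof. by rewrite dotpC dotpZl dotpC. Qed.

Lemma dotpNl u w : dotp (- u) w = - dotp u w.
Proof. by rewrite -scaleN1r dotpZl mulN1r. Qed.

Lemma dotpNr u w : dotp w (- u) = - dotp w u.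
Proof. by rewrite dotpC dotpNl dotpC. Qed.

Definition dotpE := (dotpDl, dotpDr, dotpNl, dotpNr, dotpZl, dotpZr).

Lemma dotp_ge0 u : 0 <= dotp u u.
Proof. by apply: sumr_ge0 => i _; rewrite -expr2 sqr_ge0. Qed.

Lemma enorm_ge0 u : 0 <= enorm u.
Proof. exact: sqrtr_ge0. Qed.

Lemma sqr_enorm u : enorm u ^+ 2 = dotp u u.
Proof.
rewrite /enorm sqr_sqrtr; first by apply: eq_bigr => i _; rewrite expr2.
by apply: sumr_ge0 => i _; exact: sqr_ge0.
Qed.

Lemma enorm0 : enorm (0 : 'rV[R]_p) = 0.
Proof. by rewrite /enorm big1 ?sqrtr0// => i _; rewrite mxE expr0n. Qed.

Lemma enormN u : enorm (- u) = enorm u.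
Proof. by congr Num.sqrt; apply: eq_bigr => i _; rewrite mxE sqrrN. Qed.

Lemma enormZ a u : enorm (a *: u) = `|a| * enorm u.
Proof.
apply/eqP; rewrite -(@eqrXn2 _ 2) ?mulr_ge0 ?enorm_ge0//.
by rewrite exprMn !sqr_enorm dotpZl dotpZr mulrA -expr2 real_normK ?num_real.
Qed.

(** Cauchy-Schwarz: the square of [dotp v v *: u - dotp u v *: v] is [dotp v v] times the Gram
    determinant. The factor can be cancelled only if it is nonzero, hence the case split. *)
Lemma dotp_sqr_le u v : dotp u v ^+ 2 <= dotp u u * dotp v v.
Proof.
have [v0|vn0] := eqVneq (dotp v v) 0.
  suff -> : dotp u v = 0 by rewrite v0 mulr0 expr0n.
  have : \sum_(i < p) v ord0 i ^+ 2 == 0.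
    by rewrite -[X in X == _]/(dotp v v) v0.
  rewrite psumr_eq0 => [/allP h|i _]; last exact: sqr_ge0.
  apply: big1 => i _.
  by have := h i (mem_index_enum i); rewrite sqrf_eq0 => /eqP ->; rewrite mulr0.
have v0 : 0 < dotp v v by rewrite lt_def vn0 dotp_ge0.
have := dotp_ge0 (dotp v v *: u - dotp u v *: v).
rewrite !dotpE (dotpC v u).
rewrite [X in 0 <= X](_ : _ = dotp v v * (dotp u u * dotp v v - dotp u v ^+ 2));
  last by ring.
by rewrite pmulr_rge0// subr_ge0.
Qed.

Lemma dotp_le_enorm u v : dotp u v <= enorm u * enorm v.
Proof.
apply: le_trans (ler_norm _) _.
rewrite -(@ler_pXn2r _ 2) ?nnegrE ?mulr_ge0 ?enorm_ge0//.
by rewrite exprMn !sqr_enorm real_normK ?num_real// dotp_sqr_le.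
Qed.

Lemma coord_le_enorm u i : `|u ord0 i| <= enorm u.
Proof.
rewrite -(@ler_pXn2r _ 2) ?nnegrE ?enorm_ge0// sqr_enorm real_normK ?num_real//.
rewrite /dotp (bigD1 i)//= -expr2 lerDl sumr_ge0// => j _.
by rewrite -expr2 sqr_ge0.
Qed.

Lemma dotp_continuous (h k : 'rV[R]_p -> 'rV[R]_p) :
  continuous h -> continuous k -> continuous (fun z => dotp (h z) (k z)).
Proof.
have coordc (l : 'rV[R]_p -> 'rV[R]_p) i : continuous l ->
    continuous ((fun M : 'rV[R]_p => M ord0 i) \o l).
  by move=> cl z; apply: continuous_comp; [exact: cl | exact: coord_continuous].
move=> ch ck; apply: continuous_big => [|i _ z]; first exact: add_continuous.
exact: (continuousM (coordc h i ch z) (coordc k i ck z)).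
Qed.

Lemma sqr_enormB_continuous u :
  continuous (fun z : 'rV[R]_p => enorm (z - u) ^+ 2).
Proof.
under eq_fun do rewrite sqr_enorm.
have cB : continuous (fun z : 'rV[R]_p => z - u).
  by move=> w; apply: (@continuousB _ _ _ id (cst u));
    [exact: cvg_id | exact: cst_continuous].
exact: dotp_continuous.
Qed.

End Euclidean.

(* Otherwise the open sets [phi z > phi a], a in A, cover A; among finitely many
   centres, one where phi is minimal is not covered. *)
Lemma lower_semicontinuous_compact_min (R : realType) (X : ptopologicalType)
    (phi : X -> \bar R) (A : set X) :
  lower_semicontinuous phi -> compact A -> A !=set0 ->
  exists2 a, A a & forall b, A b -> (phi a <= phi b)%E.
Proof.
move=> lsc; rewrite compact_cover => cA [a0 Aa0].
apply: contrapT => /forall2NP noM.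
have opn a : open [set z | (phi a < phi z)%E].
  rewrite openE => z /= az.
  case E : (phi a) az => [r||] az.
  - by have [V Vz hV] := lsc z r az; apply: filterS Vz => y /hV.
  - by move: az; rewrite ltNge leey.
  (* Lower semicontinuity is stated for real levels, so when [phi a] is [-oo] a real level below
     [phi z] has to be inserted. *)
  - have [r rz] : exists r : R, (r%:E < phi z)%E.
      case: (phi z) az => [r||]// _; last by exists 0; rewrite ltry.
      by exists (r - 1); rewrite lte_fin; lra.
    by have [V Vz hV] := lsc z r rz; apply: filterS Vz => y /hV; exact/lt_trans/ltNyr.
have [||D DA Dcov] := cA X A (fun a => [set z | (phi a < phi z)%E]).
- by move=> a _; exact: opn.
- move=> b Ab; apply: contrapT => nb.
  have [//|] := noM b; apply=> c Ac; rewrite leNgt; apply/negP => cb.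
  by apply: nb; exists c.
have [b0 b0D _] := Dcov a0 Aa0.
pose s := finmap.enum_fset D.
have hs b : b \in s -> A b by move=> bs; have := DA b bs; rewrite inE.
have [m ms hm] : exists2 m, m \in s & forall b, b \in s -> (phi m <= phi b)%E.
  move: (b0D : b0 \in s); move: s {hs} b0 {Dcov b0D}; elim => // c s IHs b1 _.
  have [->|[b bs]] : s = [::] \/ exists b, b \in s.
  - by case: s {IHs} => [|b s]; [left | right; exists b; exact: mem_head].
  - by exists c; rewrite ?mem_head// => b; rewrite inE => /eqP ->.
  have [{bs}b bs hb] := IHs b bs.
  have [bc|/ltW cb] := leP (phi b) (phi c).
    exists b; first by rewrite inE bs orbT.
    by move=> e; rewrite inE => /orP[/eqP ->//|/hb].
  exists c; first exact: mem_head.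
  by move=> e; rewrite inE => /orP[/eqP ->//|/hb]; exact: le_trans.
have [c cD /=] := Dcov m (hs m ms).
by rewrite ltNge hm.
Qed.

(** * The proximal map *)

(** Replaces the limit [t -> 0] in first-order optimality arguments. If [a < 0 < b], the choice
    [t = - a / (b - a)] gives the negative value [- a ^+ 2 / (b - a)]. *)
Lemma ge0_of_le_small (R : realFieldType) (a b : R) :
  (forall t, 0 < t -> t <= 1 -> 0 <= a + t * b) -> 0 <= a.
Proof.
move=> h; rewrite leNgt; apply/negP => a0.
have [b0|b0] := leP b 0; first by have := h 1 ltr01 (lexx _); lra.
have ba : 0 < b - a by lra.
have t1 : - a / (b - a) <= 1 by rewrite ler_pdivrMr//; lra.
have t0 : 0 < - a / (b - a) by rewrite divr_gt0//; lra.
have := h _ t0 t1.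
have -> : a + - a / (b - a) * b = - (a ^+ 2) / (b - a) by field; lra.
by rewrite mulNr oppr_ge0 leNgt divr_gt0// exprn_even_gt0//= lt_eqF.
Qed.

(** Bounded in the sup norm because each coordinate is at most the Euclidean norm, and closed as a
    sublevel set of the continuous squared distance. *)
Lemma compact_edisk (R : realType) (p : nat) (z0 : 'rV[R]_p) (r : R) :
  compact [set z | enorm (z - z0) <= r].
Proof.
have [r0|r0] := ltP r 0.
  rewrite (_ : [set z | _] = set0); first exact: compact0.
  rewrite -subset0 => z /= h.
  by have := le_lt_trans h r0; rewrite ltNge enorm_ge0.
apply: bounded_closed_compact.
  exists (r + enorm z0); split; first exact: num_real.
  move=> M rM z /= zr; rewrite /Num.norm /= mx_normrE.
  apply/bigmax_leP; split => [|[i j] _ /=].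
    by have := enorm_ge0 z0; lra.
  rewrite (ord1 i); have := coord_le_enorm (z - z0) j; rewrite !mxE.
  have := coord_le_enorm z0 j.
  by have := ler_normD (z ord0 j - z0 ord0 j) (z0 ord0 j); rewrite subrK; lra.
rewrite (_ : [set z | _] = (fun z => enorm (z - z0) ^+ 2) @^-1` [set y | y <= r ^+ 2]).
  apply: closed_comp; last exact: closed_le.
  by move=> y _; exact: sqr_enormB_continuous.
by apply/seteqP; split => z /=; rewrite ler_pXn2r// ?nnegrE ?enorm_ge0.
Qed.

Section Prox.
Context {R : realType} {p : nat} {psi : 'rV[R]_p -> \bar R}.
Hypothesis psi_proper : proper_function psi.
Hypothesis psi_convex : econvex_function psi.
Hypothesis psi_lsc : lower_semicontinuous psi.

Lemma proper_fin_num u : (psi u < +oo)%E -> psi u \is a fin_num.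
Proof. by move=> ?; rewrite fin_real// psi_proper.1. Qed.

Let pen (eta : R) (u z : 'rV[R]_p) : \bar R :=
  (eta%:E * psi z + (2^-1 * enorm (z - u) ^+ 2)%:E)%E.

Lemma pen_lsc eta u : 0 < eta -> lower_semicontinuous (pen eta u).
Proof.
move=> eta0 z a az.
pose q (y : 'rV[R]_p) := 2^-1 * enorm (y - u) ^+ 2.
have cq : continuous q.
  rewrite (_ : q = cst 2^-1 \* (fun y => enorm (y - u) ^+ 2))//.
  move=> y; apply: continuousM; first exact: cst_continuous.
  exact: sqr_enormB_continuous.
(* A real [b] strictly below [psi z] splits the level [a] between the two summands, each of which is
   then controlled on its own neighbourhood. For finite [psi z], [b] puts [eta * b + q z] midway
   between [a] and the value at [z]. *)
have [b bz cz] : exists2 b, (b%:E < psi z)%E & a < eta * b + q z.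
  move: az; rewrite /pen -/(q z).
  case: (psi z) => [r||].
  - rewrite -EFinM -EFinD lte_fin => h.
    exists (r - (eta * r + q z - a) / (2 * eta)).
      by rewrite lte_fin ltrBlDr ltrDl divr_gt0//; lra.
    have -> : eta * (r - (eta * r + q z - a) / (2 * eta)) + q z =
       (eta * r + q z + a) / 2 by field; lra.
    by lra.
  - move=> _; exists ((a - q z + 1) / eta); first by rewrite ltry.
    by rewrite mulrC divfK ?gt_eqF//; lra.
  - by rewrite gt0_muleNy ?lte_fin// addNye ltNge leNye.
have [V Vz hV] := psi_lsc bz.
have nq : nbhs z (q @^-1` [set r | a - eta * b < r]).
  by apply: (cq z); apply: open_nbhs_nbhs; split; [exact: open_gt | rewrite /=; lra].
exists (V `&` [set y | a - eta * b < q y]); first exact: filterI.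
move=> y [/hV by_ /= qy]; rewrite /pen -/(q y).
move: by_; case: (psi y) => [r||].
- rewrite lte_fin -EFinM -EFinD lte_fin => br.
  have : eta * b < eta * r by rewrite ltr_pM2l.
  by lra.
- by move=> _; rewrite gt0_muley ?lte_fin// addye// ltry.
- by rewrite ltNge leNye.
Qed.

Lemma proper_fine (v : 'rV[R]_p) : (psi v < +oo)%E -> psi v = (fine (psi v))%:E.
Proof. by move=> v1; rewrite fineK ?proper_fin_num. Qed.

Lemma fine_convex (t : R) (v w : 'rV[R]_p) : 0 <= t -> t <= 1 ->
  (psi v < +oo)%E -> (psi w < +oo)%E ->
  (psi (t *: v + (1 - t) *: w)%R < +oo)%E /\
  fine (psi (t *: v + (1 - t) *: w)) <=
    t * fine (psi v) + (1 - t) * fine (psi w).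
Proof.
move=> t0 t1 v1 w1; have := psi_convex v w t0 t1.
rewrite (proper_fine v1) (proper_fine w1) -!EFinM -EFinD /= => h.
have dom := le_lt_trans h (ltry _).
by split=> //; move: h; rewrite (proper_fine dom) lee_fin.
Qed.

(* psi is bounded below on the unit ball around z0 by compactness, and convexity
   along the rays from z0 propagates this bound. *)
Lemma proper_affine_minorant (z0 : 'rV[R]_p) : (psi z0 < +oo)%E ->
  exists2 c, 0 <= c & forall z, (psi z < +oo)%E ->
    fine (psi z0) - c * (1 + enorm (z - z0)) <= fine (psi z).
Proof.
move=> z0dom.
have z0B : enorm (z0 - z0) <= 1 by rewrite subrr enorm0.
have [m mB hm] := lower_semicontinuous_compact_min psi_lsc
  (@compact_edisk R p z0 1) (ex_intro _ z0 z0B).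
have mdom := le_lt_trans (hm _ z0B) z0dom.
have ms : fine (psi m) <= fine (psi z0).
  by have := hm _ z0B; rewrite (proper_fine mdom) (proper_fine z0dom) lee_fin.
exists (fine (psi z0) - fine (psi m)); first by rewrite subr_ge0.
move=> z zdom; have r0 := enorm_ge0 (z - z0); set r := enorm _ in r0 *.
have [r1|r1] := leP r 1.
  have := hm _ r1; rewrite (proper_fine mdom) (proper_fine zdom) lee_fin.
  by nra.
have rn0 : r != 0 by rewrite gt_eqF// (lt_trans ltr01 r1).
have t0 : 0 <= r^-1 by rewrite invr_ge0.
have t1 : r^-1 <= 1 by rewrite invf_le1//; lra.
(* The convex combination [w] is the point of the segment from [z0] to [z] at distance 1 from [z0],
   where the minimum over the unit ball applies. *)
have [wdom hw] := fine_convex t0 t1 zdom z0dom.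
set w := _ + _ in wdom hw.
have wB : enorm (w - z0) <= 1.
  rewrite (_ : w - z0 = r^-1 *: (z - z0)).
    by rewrite enormZ ger0_norm// -/r mulVf.
  by rewrite /w scalerBl scale1r scalerBr addrA addrAC addrK.
have := hm _ wB; rewrite (proper_fine mdom) (proper_fine wdom) lee_fin => mw.
have : r * fine (psi m) <= r * (r^-1 * fine (psi z) + (1 - r^-1) * fine (psi z0)).
  by rewrite ler_wpM2l// (le_trans mw).
rewrite mulrDr !mulrA mulrBr mulr1 mulfV// mul1r.
by lra.
Qed.

(** [xget] meets its specification once some minimizer exists. The affine minorant of [psi] makes
    the penalized function coercive, so its minimum over a large enough disk is global. *)
Lemma prox_argmin (eta : R) (u : 'rV[R]_p) : 0 < eta ->
  argmin (pen eta u) (prox psi eta u).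
Proof.
move=> eta0; apply: xgetPex => /=.
have [z0 z0dom] := psi_proper.2.
have [c c0 hc] := proper_affine_minorant z0dom.
pose A := enorm (z0 - u); have A0 : 0 <= A by exact: enorm_ge0.
(* A point at distance [r] from [z0] whose value does not exceed that of [z0] satisfies [r ^+ 2 <= 4
   * A ^+ 2 + 4 * (eta * c) * (1 + r)]; this radius makes [r > rho] contradict it. *)
pose rho := 4 * A ^+ 2 + 8 * eta * c + 1.
have ec0 : 0 <= eta * c by rewrite mulr_ge0// ltW.
have rho1 : 1 <= rho by rewrite /rho; have := sqr_ge0 A; nra.
have z0B : enorm (z0 - z0) <= rho.
  by rewrite subrr enorm0; lra.
have [x xB hx] := lower_semicontinuous_compact_min (@pen_lsc eta u eta0)
  (@compact_edisk R p z0 rho) (ex_intro _ z0 z0B).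
exists x => z; have [zz0|/ltW zz0] := leP (pen eta u z) (pen eta u z0); last first.
  by apply: le_trans zz0; exact: hx.
apply: hx => /=; rewrite leNgt; apply/negP.
have r0 := enorm_ge0 (z - z0); set r := enorm _ in r0 * => rhor.
have zdom : (psi z < +oo)%E.
  rewrite ltNge leye_eq; apply/negP => /eqP E.
  move: zz0; rewrite /pen E gt0_muley ?lte_fin// addye// (proper_fine z0dom).
  by rewrite leNgt ltry.
move: zz0; rewrite /pen (proper_fine z0dom) (proper_fine zdom) -!EFinM -!EFinD lee_fin.
rewrite -/A => zz0.
have r2 : r ^+ 2 <= 2 * enorm (z - u) ^+ 2 + 2 * A ^+ 2.
  have := dotp_ge0 ((z - u) + (z0 - u)).
  rewrite /r /A !sqr_enorm !dotpE (dotpC z z0) (dotpC z u) (dotpC z0 u).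
  by lra.
have := hc z zdom; rewrite -/r => hcz.
have hcz' : eta * (fine (psi z0) - c * (1 + r)) <= eta * fine (psi z) by rewrite ler_pM2l.
have : r ^+ 2 <= 4 * A ^+ 2 + 4 * (eta * c) + 4 * (eta * c) * r by nra.
have : rho * r < r ^+ 2 by rewrite expr2 ltr_pM2r//; lra.
have : A ^+ 2 <= A ^+ 2 * r by rewrite ler_peMr ?sqr_ge0//; lra.
have : (eta * c) <= (eta * c) * r by rewrite ler_peMr//; lra.
by rewrite /rho; nra.
Qed.

Lemma prox_dom (eta : R) (u : 'rV[R]_p) : 0 < eta ->
  (psi (prox psi eta u) < +oo)%E.
Proof.
move=> eta0; have [z0 z0dom] := psi_proper.2.
have := prox_argmin u eta0 z0; rewrite /pen (proper_fine z0dom) -EFinM -EFinD.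
rewrite !ltNge !leye_eq => h; apply/negP => /eqP E; move: h.
by rewrite E gt0_muley ?lte_fin// addye// leNgt ltry.
Qed.

(** Optimality condition: [(u - x) / eta] is a subgradient of [psi] at [x]. Compare [x] with
    [x + t (z - x)], use convexity, divide by [t] and let [t] vanish. *)
Lemma prox_variational (eta : R) (u z : 'rV[R]_p) (x := prox psi eta u) :
  0 < eta -> (psi z < +oo)%E ->
  eta * fine (psi x) + dotp (u - x) (z - x) <= eta * fine (psi z).
Proof.
move=> eta0 zdom; have xdom : (psi x < +oo)%E by exact: prox_dom.
suff : 0 <= eta * fine (psi z) - eta * fine (psi x) - dotp (u - x) (z - x) by lra.
apply: (@ge0_of_le_small _ _ (2^-1 * dotp (z - x) (z - x))) => t t0 t1.
have [wdom hw] := fine_convex (ltW t0) t1 zdom xdom.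
set w := _ + _ in wdom hw.
have := prox_argmin u eta0 w; rewrite -/x /pen (proper_fine xdom) (proper_fine wdom).
rewrite -!EFinM -!EFinD lee_fin !sqr_enorm.
have -> : w - u = (x - u) + t *: (z - x).
  by apply/rowP => i; rewrite !mxE; ring.
have : eta * fine (psi w) <= eta * (t * fine (psi z) + (1 - t) * fine (psi x)).
  by rewrite ler_pM2l.
rewrite -(opprB x u); move: (z - x) (x - u) => d e.
rewrite !dotpE (dotpC d e) => h1 h2.
rewrite -(pmulr_rge0 _ t0).
by lra.
Qed.

(** Adding the variational inequalities of the two proximal points, each tested at the other, gives
    firm nonexpansiveness; Cauchy-Schwarz then cancels one factor. *)
Lemma prox_nonexpansive (eta : R) (u v : 'rV[R]_p) : 0 < eta ->
  enorm (prox psi eta u - prox psi eta v) <= enorm (u - v).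
Proof.
move=> eta0; set x := prox psi eta u; set y := prox psi eta v.
have xdom : (psi x < +oo)%E by exact: prox_dom.
have ydom : (psi y < +oo)%E by exact: prox_dom.
have h1 := prox_variational u eta0 ydom.
have h2 := prox_variational v eta0 xdom.
rewrite -/x -/y in h1 h2.
have h : enorm (x - y) ^+ 2 <= dotp (u - v) (x - y).
  by move: h1 h2; rewrite sqr_enorm !dotpE (dotpC y x); lra.
have := le_trans h (dotp_le_enorm _ _).
have := enorm_ge0 (x - y); rewrite le_eqVlt => /orP[/eqP <-|p0]; first by rewrite enorm_ge0.
by rewrite expr2 ler_pM2r.
Qed.

End Prox.

(** * Smooth convex functions *)

(** After subtracting the quadratic [t * dphi 0 + M / 2 * t ^+ 2], the derivative is nonpositive on
    the unit interval, and the mean value theorem concludes. *)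
Lemma taylor1_upper (R : realType) (phi dphi : R -> R) (M : R) :
  (forall t : R, is_derive t 1 phi (dphi t)) ->
  (forall t, 0 <= t -> dphi t - dphi 0 <= M * t) ->
  phi 1 - phi 0 <= dphi 0 + M / 2.
Proof.
move=> hd hM.
pose k t := phi t - (t * dphi 0 + M / 2 * t ^+ 2).
have dk (t : R) : is_derive t 1 k (dphi t - (dphi 0 + M * t)).
  rewrite /k; apply: is_deriveB.
  apply: is_derive_eq.
  by rewrite !scaler0 ?addr0 ?add0r /GRing.scale /= ?mulr1; field.
have ck : {within `[0, 1], continuous k}.
  by apply: derivable_within_continuous => t _; exact: (@ex_derive _ _ _ _ _ _ _ (dk t)).
have [c] := MVT ltr01 (fun t _ => dk t) ck.
rewrite in_itv /= => /andP[c0 c1].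
have := hM c (ltW c0); rewrite /k subr0 mulr1 => h1 h2.
by lra.
Qed.

Lemma convex_function_le (R : realType) (p : nat) (f : 'rV[R]_p -> R) (t : R) x y :
  convex_function setT f -> 0 <= t -> t <= 1 ->
  f (t *: x + (1 - t) *: y) <= t * f x + (1 - t) * f y.
Proof.
move=> cf t0 t1.
have t01 : Itv.spec (@Itv.num_sem R) (Itv.Real `[0%Z, 1%Z]) t.
  by rewrite /= /Itv.num_sem/= num_real/= in_itv /= t0.
exact: (cf (Itv.mk t01) x y (in_setT _) (in_setT _)).
Qed.

Section Smooth.
Context {R : realType} {p : nat} {L : R} {f : 'rV[R]_p -> R}.
Hypothesis f_smooth : smooth L f.

(** [grad] collects partial derivatives only; differentiability makes the directional derivative
    linear in [v], so they determine it. *)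
Lemma derive_grad u v : 'D_v f u = dotp (grad f u) v.
Proof.
have df := f_smooth.1 u.
rewrite deriveE// {1}(row_sum_delta v) linear_sum /=.
by apply: eq_bigr => i _; rewrite linearZ /= mxE -deriveE// mulrC.
Qed.

Lemma is_derive_line y v (t : R) :
  is_derive t 1 (fun s => f (y + s *: v)) (dotp (grad f (y + t *: v)) v).
Proof.
have E : (fun h : R => h^-1 *: (f (y + (h *: 1 + t) *: v) - f (y + t *: v)))
    = (fun h => h^-1 *: (f (h *: v + (y + t *: v)) - f (y + t *: v))).
  apply/funext => h; congr (_ *: (f _ - _)).
  by rewrite scalerDl addrCA [h *: 1]mulr1.
have dv : derivable f (y + t *: v) v by exact/diff_derivable/f_smooth.1.
split; first by rewrite /derivable /= E.
by rewrite -derive_grad /derive /= E.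
Qed.

(** Along the segment the slope changes by at most [L * enorm v ^+ 2 * t]. Applying [taylor1_upper]
    to the restriction and to its opposite gives both sides: the upper one yields [descent], the
    lower one [convex_grad_le]. *)
Lemma smooth_taylor1 y v :
  `|f (y + v) - f y - dotp (grad f y) v| <= L / 2 * enorm v ^+ 2.
Proof.
have gl t : 0 <= t ->
    `|dotp (grad f (y + t *: v)) v - dotp (grad f y) v| <= L * enorm v ^+ 2 * t.
  move=> t0.
  rewrite -dotpNl -dotpDl.
  have h (w : 'rV[R]_p) : `|dotp w v| <= enorm w * enorm v.
    by rewrite ler_norml dotp_le_enorm andbT lerNl -dotpNl -(enormN w) dotp_le_enorm.
  apply: le_trans (h _) _.
  have := f_smooth.2 (y + t *: v) y.
  rewrite [y + _ - y]addrAC subrr add0r enormZ ger0_norm// => h1.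
  have -> : L * enorm v ^+ 2 * t = L * (t * enorm v) * enorm v by ring.
  by rewrite ler_wpM2r// enorm_ge0.
have dl := is_derive_line y v.
have up := @taylor1_upper _ (fun s => f (y + s *: v))
  (fun t => dotp (grad f (y + t *: v)) v) (L * enorm v ^+ 2) dl.
have dn := @taylor1_upper _ (- (fun s => f (y + s *: v)))
  (fun t => - dotp (grad f (y + t *: v)) v) (L * enorm v ^+ 2)
  (fun t => is_deriveN (dl t)).
rewrite /= !scale0r !scale1r !addr0 in up dn.
have {}up := up (fun t t0 => le_trans (ler_norm _) (gl t t0)).
rewrite ler_norml; apply/andP; split; last by lra.
suff : - f (y + v) - - f y <= - dotp (grad f y) v + L * enorm v ^+ 2 / 2 by lra.
apply: le_trans (dn _); first by rewrite /GRing.opp /= !scale0r !scale1r !addr0.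
move=> t t0; rewrite -opprD lerNl.
by have := gl t t0; rewrite ler_norml => /andP[].
Qed.

Lemma descent x y :
  f x <= f y + dotp (grad f y) (x - y) + L / 2 * enorm (x - y) ^+ 2.
Proof.
have := smooth_taylor1 y (x - y); rewrite [y + _]addrC subrK => h.
by have := le_trans (ler_norm _) h; lra.
Qed.

(** Convexity at [y + t (x - y)] combined with the lower Taylor bound leaves an error of order
    [t ^+ 2], which disappears after division by [t]. *)
Lemma convex_grad_le x y : convex_function setT f -> 
  f y + dotp (grad f y) (x - y) <= f x.
Proof.
move=> cf; suff : 0 <= f x - f y - dotp (grad f y) (x - y) by lra.
apply: (@ge0_of_le_small _ _ (L / 2 * enorm (x - y) ^+ 2)) => t t0 t1.
have := smooth_taylor1 y (t *: (x - y)).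
rewrite ler_norml => /andP[h _].
have := convex_function_le x y cf (ltW t0) t1.
rewrite (_ : t *: x + (1 - t) *: y = y + t *: (x - y)); last first.
  by apply/rowP => i; rewrite !mxE; ring.
move: h; rewrite dotpZr enormZ (gtr0_norm t0) => h h2.
rewrite -(pmulr_rge0 _ t0).
by lra.
Qed.

End Smooth.

(** * Measurability and square integrability *)

Section MeasurableWrt.
Context {d : measure_display} {T : measurableType d} {R : realType}.
Variables (G : set (set T)) (sG : sigma_algebra setT G).

(** Bridge from a bare sigma-algebra [G] to the library's measurable types: the sigma-algebra
    generated by [G] is [G] itself. *)
Lemma measurable_wrtP (X : T -> R) :
  measurable_wrt G X <->
  measurable_fun setT (X : g_sigma_algebraType G -> R).
Proof.
split => [h _ B mB|h B mB].
  by rewrite setTI measurable_g_measurableTypeE//; exact: h.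
by have := h measurableT B mB; rewrite setTI measurable_g_measurableTypeE.
Qed.

(** An open set is a countable union of boxes with rational centre and radius [1 / (n + 1)]; the
    preimage of a box is a finite intersection of coordinate events. *)
Lemma vec_measurable_wrt_open p (X : T -> 'rV[R]_p) (U : set 'rV[R]_p) :
  vec_measurable_wrt G X -> open U -> G (X @^-1` U).
Proof.
move=> mX oU.
pose B (qn : 'rV[rat]_p * nat) : set 'rV[R]_p :=
  [set z | forall i, `|z ord0 i - ratr (qn.1 ord0 i)| < qn.2.+1%:R^-1].
have -> : X @^-1` U = \bigcup_qn (X @^-1` (if `[< B qn `<=` U >] then B qn else set0)).
  apply/seteqP; split => w; last first.
    by move=> [qn _ /=]; case: asboolP => // BU /BU.
  move=> /= XU; have := open_nbhs_nbhs (conj oU XU) => /nbhs_ballP[e /= e0 eU].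
  (* Half of [e]: one radius from [X w] to the rational centre, one from the centre to the points of
     the box. *)
  have [n ne] : exists n, n.+1%:R^-1 < e / 2 :> R.
    have e20 : 0 < e / 2 by rewrite divr_gt0.
    by have /cvgrPdist_lt /(_ _ e20) [N _ /(_ N (leqnn N))] := @cvg_harmonic R;
       rewrite /= sub0r normrN gtr0_norm// => ?; exists N.
  have n0 : 0 < n.+1%:R^-1 :> R by rewrite invr_gt0.
  have hq i : exists r : rat, `|X w ord0 i - ratr r| < n.+1%:R^-1.
    move: n0; move: (n.+1%:R^-1) => c c0.
    have /rat_in_itvoo[r] : X w ord0 i - c < X w ord0 i + c by lra.
    rewrite in_itv /= => /andP[r1 r2]; exists r.
    by rewrite ltr_norml; apply/andP; split; lra.
  exists (\row_i projT1 (cid (hq i)), n) => //=.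
  case: asboolP => [_|]; first by move=> i; rewrite mxE; case: (cid _).
  case => z Bz; apply: eU; split=> [//|i j]; rewrite (ord1 i).
  have := Bz j; rewrite /= mxE; case: (cid _) => r /= r1 r2.
  rewrite /ball /=.
  have := ler_distD (ratr r) (X w ord0 j) (z ord0 j).
  rewrite (distrC (ratr r)).
  by move: ne r1 r2 {n0 hq Bz}; move: (n.+1%:R^-1) => c ? ? ? ?; lra.
rewrite -(measurable_g_measurableTypeE sG).
apply: countable_bigcupT_measurable => // qn.
case: asboolP => _; last by rewrite preimage_set0; exact: measurable0.
rewrite (_ : X @^-1` B qn = \bigcap_(i in [set: 'I_p])
   ((fun w => X w ord0 i) @^-1` [set r | `|r - ratr (qn.1 ord0 i)| < qn.2.+1%:R^-1])).
  apply: fin_bigcap_measurable => // i _.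
  rewrite measurable_g_measurableTypeE//; apply: mX.
  apply: open_measurable.
  rewrite (_ : [set r | _] = ball (ratr (qn.1 ord0 i) : R) (qn.2.+1%:R^-1)).
    exact: ball_open.
  by apply/seteqP; split => r; rewrite /ball /= distrC.
by apply/seteqP; split => w /= h i; [move=> _; exact: h | exact: (h i I)].
Qed.

(** Strict superlevel sets of [h] are open, and the rays above a real generate the Borel sets of the
    extended reals. This makes [psi] of an iterate measurable. *)
Lemma measurable_wrt_lsc p (X : T -> 'rV[R]_p) (h : 'rV[R]_p -> \bar R) :
  vec_measurable_wrt G X -> lower_semicontinuous h ->
  measurable_fun setT (h \o X : g_sigma_algebraType G -> \bar R).
Proof.
move=> mX /lower_semicontinuousP lsc.
apply: (measurability _ (ErealGenOInfty.measurableE R)) => _ [_ [a ->] <-].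
rewrite setTI preimage_itvoy measurable_g_measurableTypeE//.
exact: (vec_measurable_wrt_open mX (lsc a)).
Qed.

Lemma measurable_wrt_continuous p (X : T -> 'rV[R]_p) (h : 'rV[R]_p -> R) :
  vec_measurable_wrt G X -> continuous h -> measurable_wrt G (h \o X).
Proof.
move=> mX ch; apply/measurable_wrtP.
apply: (measurability _ (RGenOpens.measurableE R)) => _ [_ [a [b ->]] <-].
rewrite setTI measurable_g_measurableTypeE// comp_preimage.
apply: (vec_measurable_wrt_open mX).
by apply: open_comp; [move=> ? _; exact: ch|exact: interval_open].
Qed.

End MeasurableWrt.

(** * Conditionally centred variables are orthogonal to [G]-measurable ones *)

Section ZeroCorrelation.
Context {d : measure_display} {T : measurableType d} {R : realType}.
Variable P : probability T R.

Lemma measurable_wrt_measurable_fun (G : set (set T)) (X : T -> R) :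
  G `<=` @measurable d T -> measurable_wrt G X -> measurable_fun setT X.
Proof. by move=> Gm mX _ B mB; rewrite setTI; exact/Gm/mX. Qed.

Lemma integrable_le (u v : T -> R) : measurable_fun setT u ->
  (forall w, `|u w| <= v w) -> P.-integrable setT (EFin \o v) ->
  P.-integrable setT (EFin \o u).
Proof.
move=> mu uv; apply: le_integrable => //; first exact/measurable_EFinP.
by move=> w _; rewrite /= lee_fin (le_trans (uv w))// ler_norm.
Qed.

Variables (G : set (set T)) (sG : sigma_algebra setT G).
Hypothesis Gm : G `<=` @measurable d T.
Variable e : T -> R.
Hypothesis int_e : P.-integrable setT (EFin \o e).
Hypothesis e0 : forall A, G A -> (\int[P]_(w in A) (e w)%:E = 0)%E.

Let me : measurable_fun setT e.
Proof. by have /integrableP[/measurable_EFinP] := int_e. Qed.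

(** First of three stages, through simple, nonnegative and signed [h]. Here [h] is the finite sum of
    its values times indicators of level sets, which lie in [G]. *)
Lemma integral_mul_simple_eq0 (h : T -> R) : finite_set (range h) ->
  (forall y, G (h @^-1` [set y])) ->
  (\int[P]_w (e w * h w)%:E = 0)%E.
Proof.
move=> fh Gh; pose A y := h @^-1` [set y].
have intA y : P.-integrable setT (fun w => ((e w)%:E * (\1_(A y) w)%:E)%E).
  have -> : (fun w => ((e w)%:E * (\1_(A y) w)%:E)%E) = EFin \o (fun w => e w * \1_(A y) w).
    by apply/funext => w /=; rewrite EFinM.
  apply: (@integrable_le _ (fun w => `|e w|)).
  - by apply: measurable_funM => //; apply: measurable_indic; exact/Gm/Gh.
  - by move=> w; rewrite indicE normrM; case: (w \in _); rewrite ?normr1 ?normr0 ?mulr1 ?mulr0.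
  - exact: (integrable_norm int_e).
rewrite (_ : (fun w => _) = (fun w => (\sum_(y <- finmap.enum_fset (fset_set (range h)))
    y%:E * ((e w)%:E * (\1_(A y) w)%:E))%E)); last first.
  apply/funext => w; rewrite (bigD1_seq (h w)) ?finmap.fset_uniq//=; last first.
    by rewrite in_fset_set// inE; exists w.
  rewrite big1 ?adde0 => [|y yh]; last first.
    by rewrite indicE memNset ?mule0//= /A /= => hy; rewrite hy eqxx in yh.
  by rewrite indicE mem_set// mule1 -EFinM mulrC.
rewrite integral_sum//; last by move=> y; exact: integrableZl.
rewrite big1_seq// => y _; rewrite integralZl//.
rewrite -[RHS](mule0 y%:E) -(e0 (Gh y)) [in RHS]integral_mkcond.
by congr (_ * _)%E; apply: eq_integral => w _; rewrite epatch_indic.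
Qed.

Lemma integral_mul_ge0_eq0 (h : T -> R) : measurable_wrt G h ->
  (forall w, 0 <= h w) -> P.-integrable setT (EFin \o (fun w => e w * h w)) ->
  (\int[P]_w (e w * h w)%:E = 0)%E.
Proof.
move=> mh h0 ieh.
have mh' : measurable_fun setT (EFin \o (h : g_sigma_algebraType G -> R)).
  by apply/measurable_EFinP; apply/(measurable_wrtP sG).
(* The approximation is taken over the type carrying [G], so the simple functions are
   [G]-measurable. They increase to [h], hence the products with [e] are dominated by the integrable
   [|e h|]. *)
pose a n : T -> R := nnsfun_approx measurableT mh' n.
have ac w : (a n w)%:E @[n --> \oo] --> (h w)%:E.
  exact: (@cvg_nnsfun_approx _ _ _ _ measurableT _ mh' (fun w _ => h0 w) w I).
have a0 n w : 0 <= a n w by exact: fun_ge0.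
have ah n w : a n w <= h w.
  have /fine_cvgP[_ cr] := ac w; rewrite -(cvg_lim (@Rhausdorff R) cr).
  apply: (@nondecreasing_cvgn_le _ (fun n => a n w)); last by apply/cvg_ex; exists (h w).
  by move=> i j ij; have /lefP := nd_nnsfun_approx measurableT mh' ij; exact.
have mG n : measurable_fun setT (a n : g_sigma_algebraType G -> R).
  exact: (@measurable_funPT _ _ _ _ (nnsfun_approx measurableT mh' n)).
have Ga n y : G (a n @^-1` [set y]) by exact/(measurable_wrtP sG _).2.
have man n : measurable_fun setT (a n).
  by apply: (measurable_wrt_measurable_fun Gm); exact/(measurable_wrtP sG).
have [|||||_ _] := @dominated_convergence _ _ _ P setT measurableT
  (fun n w => (e w * a n w)%:E) (fun w => (e w * h w)%:E) (fun w => `|(e w * h w)%:E|)%E.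
- by move=> n; apply/measurable_EFinP; exact: measurable_funM.
- by have /integrableP[] := ieh.
- apply: aeW => w _; under eq_fun do rewrite EFinM; rewrite EFinM.
  by apply: cvgeZl.
- exact: integrable_abse ieh.
- apply: aeW => w n _; rewrite lee_fin !normrM ler_wpM2l//.
  by rewrite !ger0_norm.
rewrite (_ : [sequence _]_n = cst 0%E); last first.
  apply/funext => n /=; apply: integral_mul_simple_eq0 => //.
  exact: (@fimfunP _ _ (nnsfun_approx measurableT mh' n)).
by move/(cvg_lim (@ereal_hausdorff R)) => <-; rewrite lim_cst.
Qed.

Lemma integral_mul_eq0 (h : T -> R) : measurable_wrt G h ->
  P.-integrable setT (EFin \o (fun w => e w * h w)) ->
  (\int[P]_w (e w * h w)%:E = 0)%E.
Proof.
move=> mh ieh; have mhT := measurable_wrt_measurable_fun Gm mh.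
have Gh := (measurable_wrtP sG h).1 mh.
have mp : measurable_wrt G (fun w => Num.max (h w) 0).
  by apply/(measurable_wrtP sG); apply: measurable_maxr.
have mn : measurable_wrt G (fun w => Num.max (- h w) 0).
  by apply/(measurable_wrtP sG); apply: measurable_maxr => //; exact: measurable_funN.
have intp : P.-integrable setT (EFin \o (fun w => e w * Num.max (h w) 0)).
  apply: (@integrable_le _ (fun w => `|e w * h w|)); last exact: (integrable_norm ieh).
    by apply: measurable_funM => //; exact: measurable_wrt_measurable_fun mp.
  move=> w; rewrite !normrM ler_wpM2l// /Num.max; case: ifP => //.
  by rewrite normr0.
have intn : P.-integrable setT (EFin \o (fun w => e w * Num.max (- h w) 0)).
  apply: (@integrable_le _ (fun w => `|e w * h w|)); last exact: (integrable_norm ieh).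
    by apply: measurable_funM => //; exact: measurable_wrt_measurable_fun mn.
  move=> w; rewrite !normrM ler_wpM2l// /Num.max; case: ifP => //.
    by rewrite normr0.
  by rewrite normrN.
have -> : (fun w => (e w * h w)%:E) =
    (fun w => ((e w * Num.max (h w) 0)%:E - (e w * Num.max (- h w) 0)%:E)%E).
  apply/funext => w; rewrite -EFinB -mulrBr; congr (_ * _)%:E.
  by rewrite /Num.max oppr_lt0; case: ltgtP => ?; lra.
rewrite integralB// integral_mul_ge0_eq0// ?integral_mul_ge0_eq0//.
- by rewrite sube0.
- by move=> w; rewrite le_max lexx orbT.
- by move=> w; rewrite le_max lexx orbT.
Qed.

End ZeroCorrelation.

(** Continuity refers to the sup-norm topology; Euclidean disks are neighbourhoods there because the
    squared distance is continuous. The constant [D] in the proof is [C] made positive, so that it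
    can be divided by. *)
Lemma enorm_lipschitz_continuous (R : realType) (p : nat)
    (h : 'rV[R]_p -> R) (C : R) :
  (forall u v, `|h u - h v| <= C * enorm (u - v)) -> continuous h.
Proof.
move=> hC u; apply: (cvgrPdist_lt (F := nbhs u) _ _).2 => eps eps0.
pose D := `|C| + 1; have D0 : 0 < D by rewrite ltr_wpDl.
have := @sqr_enormB_continuous R p u.
move=> /(_ u) /cvgrPdist_lt /(_ ((eps / D) ^+ 2)); rewrite exprn_gt0 ?divr_gt0// => /(_ isT).
apply: filterS => z; rewrite subrr enorm0 expr0n /= sub0r normrN ger0_norm ?sqr_ge0//.
rewrite ltr_pXn2r ?nnegrE ?enorm_ge0//; last first.
  by rewrite divr_ge0 ?ltW.
rewrite ltr_pdivlMr// => zu.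
apply: le_lt_trans zu; rewrite distrC; apply: le_trans (hC _ _) _.
rewrite mulrC ler_wpM2l ?enorm_ge0// /D.
by rewrite (le_trans (ler_norm _))// lerDl.
Qed.

Section VecMeasurable.
Context {d : measure_display} {T : measurableType d} {R : realType} {p : nat}.
Variables (G : set (set T)) (sG : sigma_algebra setT G).
Implicit Types X Y : T -> 'rV[R]_p.

Lemma vec_measurable_wrt_cst u : vec_measurable_wrt G (fun _ : T => u : 'rV[R]_p).
Proof. by move=> i; apply/(measurable_wrtP sG); exact: measurable_cst. Qed.

Lemma vec_measurable_wrtD X Y : vec_measurable_wrt G X -> vec_measurable_wrt G Y ->
  vec_measurable_wrt G (fun w => X w + Y w).
Proof.
move=> mX mY i; apply/(measurable_wrtP sG).
under eq_fun do rewrite mxE.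
by apply: measurable_funD; apply/(measurable_wrtP sG).
Qed.

Lemma vec_measurable_wrtZ a X : vec_measurable_wrt G X ->
  vec_measurable_wrt G (fun w => a *: X w).
Proof.
move=> mX i; apply/(measurable_wrtP sG).
under eq_fun do rewrite mxE.
by apply: measurable_funM; [exact: measurable_cst | apply/(measurable_wrtP sG)].
Qed.

Lemma vec_measurable_wrtB X Y : vec_measurable_wrt G X -> vec_measurable_wrt G Y ->
  vec_measurable_wrt G (fun w => X w - Y w).
Proof.
move=> mX mY; under eq_fun do rewrite -scaleN1r.
by apply: vec_measurable_wrtD => //; exact: vec_measurable_wrtZ.
Qed.

Lemma vec_measurable_wrt_lipschitz (h : 'rV[R]_p -> 'rV[R]_p) C X :
  (forall u v, enorm (h u - h v) <= C * enorm (u - v)) ->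
  vec_measurable_wrt G X -> vec_measurable_wrt G (h \o X).
Proof.
move=> hC mX i; apply: (measurable_wrt_continuous sG mX (h := fun u => h u ord0 i)).
apply: (@enorm_lipschitz_continuous _ _ _ C) => u v.
by rewrite (le_trans _ (hC u v))//; have := coord_le_enorm (h u - h v) i; rewrite !mxE.
Qed.

End VecMeasurable.

Lemma sigma_algebra_measurable d (T : measurableType d) :
  sigma_algebra setT (@measurable d T).
Proof.
split; first exact: measurable0.
- by move=> A mA; exact: measurableD.
- by move=> A mA; exact: bigcup_measurable.
Qed.

Lemma vec_measurable_wrtS (T : Type) (R : realType) (p : nat)
    (G H : set (set T)) (X : T -> 'rV[R]_p) :
  G `<=` H -> vec_measurable_wrt G X -> vec_measurable_wrt H X.
Proof. by move=> GH mX i B mB; exact/GH/mX. Qed.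

(** * Square-integrable random vectors *)

Section SquareIntegrable.
Context {d : measure_display} {T : measurableType d} {R : realType} {p : nat}.
Variable P : probability T R.
Implicit Types X Y : T -> 'rV[R]_p.
Implicit Types u v : T -> R.

Lemma rintegrableD u v : P.-integrable setT (EFin \o u) ->
  P.-integrable setT (EFin \o v) ->
  P.-integrable setT (EFin \o (fun w => u w + v w)).
Proof. by move=> iu iv; exact: (integrableD measurableT iu iv). Qed.

Lemma rintegrableZ (a : R) u : P.-integrable setT (EFin \o u) ->
  P.-integrable setT (EFin \o (fun w => a * u w)).
Proof. by move=> iu; exact: (integrableZl measurableT a iu). Qed.

Lemma rintegrable_cst (a : R) : P.-integrable setT (EFin \o (fun=> a)).
Proof. exact: finite_measure_integrable_cst. Qed.

Definition sq_integrable X :=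
  vec_measurable_wrt (@measurable d T) X /\
  P.-integrable setT (EFin \o (fun w => enorm (X w) ^+ 2)).

Lemma measurable_dotp X Y : vec_measurable_wrt (@measurable d T) X ->
  vec_measurable_wrt (@measurable d T) Y ->
  measurable_fun setT (fun w => dotp (X w) (Y w)).
Proof.
move=> mX mY; apply: measurable_sum => i.
by apply: measurable_funM; apply: (@measurable_wrt_measurable_fun _ _ _ measurable).
Qed.

Lemma measurable_sqr_enorm X : vec_measurable_wrt (@measurable d T) X ->
  measurable_fun setT (fun w => enorm (X w) ^+ 2).
Proof. by move=> mX; under eq_fun do rewrite sqr_enorm; exact: measurable_dotp. Qed.

Lemma sq_integrable_le X u : vec_measurable_wrt (@measurable d T) X ->
  (forall w, enorm (X w) ^+ 2 <= u w) -> P.-integrable setT (EFin \o u) ->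
  sq_integrable X.
Proof.
move=> mX Xu iu; split=> //; apply: integrable_le iu; first exact: measurable_sqr_enorm.
by move=> w; rewrite ger0_norm// sqr_ge0.
Qed.

Lemma sq_integrable_cst a : sq_integrable (fun=> a).
Proof.
split; last exact: rintegrable_cst.
by apply: vec_measurable_wrt_cst; exact: sigma_algebra_measurable.
Qed.

Lemma sqr_enormD_le (a b : 'rV[R]_p) :
  enorm (a + b) ^+ 2 <= 2 * enorm a ^+ 2 + 2 * enorm b ^+ 2.
Proof.
have := dotp_ge0 (a - b).
by rewrite !sqr_enorm !dotpE (dotpC b a); lra.
Qed.

Lemma sq_integrableD X Y : sq_integrable X -> sq_integrable Y ->
  sq_integrable (fun w => X w + Y w).
Proof.
move=> [mX iX] [mY iY].
apply: sq_integrable_le (fun w => sqr_enormD_le (X w) (Y w)) _.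
  by apply: vec_measurable_wrtD => //; exact: sigma_algebra_measurable.
by apply: rintegrableD; exact: rintegrableZ.
Qed.

Lemma sq_integrableZ a X : sq_integrable X -> sq_integrable (fun w => a *: X w).
Proof.
move=> [mX iX]; apply: (@sq_integrable_le _ (fun w => a ^+ 2 * enorm (X w) ^+ 2)).
- by apply: vec_measurable_wrtZ => //; exact: sigma_algebra_measurable.
- by move=> w; rewrite enormZ exprMn real_normK ?num_real.
- exact: rintegrableZ.
Qed.

Lemma sq_integrableB X Y : sq_integrable X -> sq_integrable Y ->
  sq_integrable (fun w => X w - Y w).
Proof.
move=> iX iY; under eq_fun do rewrite -scaleN1r.
by apply: sq_integrableD => //; exact: sq_integrableZ.
Qed.

Lemma sq_integrable_lipschitz (h : 'rV[R]_p -> 'rV[R]_p) C X :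
  (forall a b, enorm (h a - h b) <= C * enorm (a - b)) ->
  sq_integrable X -> sq_integrable (h \o X).
Proof.
move=> hC [mX iX].
apply: (@sq_integrable_le _ (fun w =>
    2 * enorm (h 0) ^+ 2 + 2 * (C ^+ 2 * enorm (X w) ^+ 2))).
- by apply: vec_measurable_wrt_lipschitz hC mX; exact: sigma_algebra_measurable.
- move=> w; have := sqr_enormD_le (h 0) (h (X w) - h 0).
  rewrite addrCA subrr addr0 => /le_trans; apply.
  rewrite lerD2l ler_pM2l// -exprMn; have := hC (X w) 0; rewrite subr0 => h1.
  by rewrite ler_pXn2r ?nnegrE ?enorm_ge0// (le_trans _ h1) ?enorm_ge0.
- by apply: rintegrableD; [exact: rintegrable_cst | do 2!apply: rintegrableZ].
Qed.

Lemma sq_integrable_dotp X Y : sq_integrable X -> sq_integrable Y ->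
  P.-integrable setT (EFin \o (fun w => dotp (X w) (Y w))).
Proof.
move=> [mX iX] [mY iY].
apply: integrable_le (rintegrableD iX iY); first exact: measurable_dotp.
move=> w; rewrite !sqr_enorm ler_norml.
have := dotp_ge0 (X w - Y w); have := dotp_ge0 (X w + Y w).
have := dotp_ge0 (X w); have := dotp_ge0 (Y w).
rewrite !dotpE (dotpC (Y w)) => *; apply/andP; split; lra.
Qed.

(** Coordinatewise use of [integral_mul_eq0]; the products are integrable because each is at most
    the sum of the squared norms. *)
Lemma integral_dotp_eq0 (G : set (set T)) (E H : T -> 'rV[R]_p) :
  sigma_algebra setT G -> G `<=` @measurable d T ->
  sq_integrable E -> sq_integrable H -> vec_measurable_wrt G H ->
  (forall i, P.-integrable setT (fun w => (E w ord0 i)%:E)) ->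
  (forall i A, G A -> (\int[P]_(w in A) (E w ord0 i)%:E = 0)%E) ->
  (\int[P]_w (dotp (E w) (H w))%:E = 0)%E.
Proof.
move=> sG Gm [mE iE] [mH iH] GH iEi E0.
have iEH i : P.-integrable setT (EFin \o (fun w => E w ord0 i * H w ord0 i)).
  apply: integrable_le (rintegrableD iE iH).
    by apply: measurable_funM; apply: (@measurable_wrt_measurable_fun _ _ _ measurable).
  move=> w; have /ler_pM := coord_le_enorm (E w) i.
  move=> /(_ _ _ (normr_ge0 _) (normr_ge0 _) (coord_le_enorm (H w) i)).
  rewrite normrM => /le_trans; apply.
  have := sqr_ge0 (enorm (E w) - enorm (H w)).
  have := sqr_ge0 (enorm (E w)); have := sqr_ge0 (enorm (H w)); nra.
under eq_integral do rewrite /dotp -sumEFin.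
rewrite integral_sum// big1// => i _.
exact: (integral_mul_eq0 sG Gm (iEi i) (E0 i) (GH i) (iEH i)).
Qed.

End SquareIntegrable.

(** * One accelerated step *)

(** Real-valued form of [objective], faithful where [psi] is finite: [fine] sends infinite values to
    0. *)
Definition robj (R : realType) (p : nat) (f : 'rV[R]_p -> R)
    (psi : 'rV[R]_p -> \bar R) (u : 'rV[R]_p) : R :=
  f u + fine (psi u).

(* An upper bound on <e, x - z>, where e = grad f y - g and x is the proximal
   step from y along g. *)
Definition step_noise (R : realType) (p : nat) (eta : R) (f : 'rV[R]_p -> R)
    (psi : 'rV[R]_p -> \bar R) (y g z : 'rV[R]_p) : R :=
  dotp (grad f y - g) (prox psi eta (y - eta *: grad f y) - z)
  + eta * enorm (grad f y - g) ^+ 2.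

Section ProxGradStep.
Context {R : realType} {p : nat} {L eta : R} {f : 'rV[R]_p -> R}
  {psi : 'rV[R]_p -> \bar R}.
Hypothesis f_convex : convex_function setT f.
Hypothesis f_smooth : smooth L f.
Hypothesis psi_proper : proper_function psi.
Hypothesis psi_convex : econvex_function psi.
Hypothesis psi_lsc : lower_semicontinuous psi.
Hypothesis eta0 : 0 < eta.
Hypothesis etaL : eta <= L^-1.

(** Sum of the variational inequality at [z], the descent inequality from [y] to [x] and the
    gradient inequality at [z]. The error term [dotp (grad f y - g) (x - z)] is split at [xb], the
    step along the exact gradient, which does not depend on [g]. *)
Lemma prox_grad_step (y g z : 'rV[R]_p) (x := prox psi eta (y - eta *: g)) :
  (psi z < +oo)%E ->
  robj f psi x + (2 * eta)^-1 * enorm (z - x) ^+ 2 <=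
  robj f psi z + (2 * eta)^-1 * enorm (z - y) ^+ 2 + step_noise eta f psi y g z.
Proof.
move=> zdom.
have L0 : 0 < L by rewrite -invr_gt0 (lt_le_trans eta0).
have hp := prox_variational psi_proper psi_convex psi_lsc (y - eta *: g) eta0 zdom.
have hd := descent f_smooth x y.
have hc := convex_grad_le f_smooth z y f_convex.
pose xb := prox psi eta (y - eta *: grad f y).
have hn : enorm (x - xb) <= eta * enorm (grad f y - g).
  apply: le_trans (prox_nonexpansive psi_proper psi_convex psi_lsc _ _ eta0) _.
  rewrite (_ : _ - _ - _ = eta *: (grad f y - g)); last first.
    by apply/rowP => i; rewrite !mxE; ring.
  by rewrite enormZ gtr0_norm.
have he : dotp (grad f y - g) (x - xb) <= eta * enorm (grad f y - g) ^+ 2.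
  apply: le_trans (dotp_le_enorm _ _) _.
  by rewrite expr2 mulrCA ler_wpM2l ?enorm_ge0.
(* Since [eta * L <= 1], the curvature term is absorbed by the square that expanding
   [dotp (y - x) (z - x)] produces. *)
have hL : eta * (L / 2 * enorm (x - y) ^+ 2) <= 2^-1 * enorm (x - y) ^+ 2.
  rewrite mulrA ler_wpM2r ?sqr_ge0// mulrA ler_piMl//.
  by rewrite -ler_pdivlMr// mul1r.
rewrite -(ler_pM2l eta0) /step_noise -/xb /robj.
have {}hd := ler_wpM2l (ltW eta0) hd.
have {}hc := ler_wpM2l (ltW eta0) hc.
have {}he := ler_wpM2l (ltW eta0) he.
have e2 : eta * (2 * eta)^-1 = 2^-1 by rewrite invfM mulrCA mulfV ?mulr1// gt_eqF.
rewrite !mulrDr !(mulrA eta (2 * eta)^-1) e2.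
rewrite -/x in hp.
move: hp hd hc he hL; rewrite !sqr_enorm.
move: (grad f y) => G; clearbody x xb.
rewrite !dotpE ?(dotpC y x) ?(dotpC z x) ?(dotpC z y).
lra.
Qed.

Lemma robj_convex t u v : 0 <= t -> t <= 1 ->
  (psi u < +oo)%E -> (psi v < +oo)%E ->
  robj f psi (t *: u + (1 - t) *: v) <= t * robj f psi u + (1 - t) * robj f psi v.
Proof.
move=> t0 t1 udom vdom.
have [_] := fine_convex psi_proper psi_convex t0 t1 udom vdom.
by have := convex_function_le u v f_convex t0 t1; rewrite /robj; lra.
Qed.

(* [v] and [v'] are the iterates of the estimate sequence: the points
   extrapolated from [xprev] through [y] and [x] by the factor [a^-1]. *)
Lemma accelerated_step a (xs xprev y g v v' : 'rV[R]_p)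
    (x := prox psi eta (y - eta *: g)) (z := a *: xs + (1 - a) *: xprev) :
  0 <= a -> a <= 1 -> (psi xs < +oo)%E -> (psi xprev < +oo)%E ->
  y = (1 - a) *: xprev + a *: v -> x = (1 - a) *: xprev + a *: v' ->
  robj f psi x - robj f psi xs + a ^+ 2 * ((2 * eta)^-1 * enorm (xs - v') ^+ 2) <=
  (1 - a) * (robj f psi xprev - robj f psi xs)
  + a ^+ 2 * ((2 * eta)^-1 * enorm (xs - v) ^+ 2)
  + step_noise eta f psi y g z.
Proof.
move=> a0 a1 sdom pdom yE xE.
have [zdom _] := fine_convex psi_proper psi_convex a0 a1 sdom pdom.
have := prox_grad_step y g zdom; rewrite -/x -/z.
have := robj_convex a0 a1 sdom pdom; rewrite -/z.
(* The points [z], [x] and [y] share the part [(1 - a) *: xprev], so the differences are multiples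
   of [a] and the squared distances carry [a ^+ 2]. *)
have -> : z - x = a *: (xs - v').
  by rewrite xE; apply/rowP => i; rewrite !mxE; ring.
have -> : z - y = a *: (xs - v).
  by rewrite yE; apply/rowP => i; rewrite !mxE; ring.
by rewrite !enormZ !exprMn !real_normK ?num_real//; lra.
Qed.

End ProxGradStep.

(** * The sequences [gamma] and [delta] for a constant step size *)

Section StepSizes.
Context {R : realType} {eta : R} {gamma delta : nat -> R}.
Hypothesis eta0 : 0 < eta.
Hypothesis deltaE : forall k, delta k = Num.sqrt (eta * gamma k).
Hypothesis gammaS : forall k, gamma k.+1 = (1 - delta k.+1) * gamma k.
Hypothesis gamma0E : gamma 0%N = eta^-1.

(** The square root of a nonpositive number is 0, so [gamma k.+1 <= 0] would force [delta k.+1 = 0]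
    and then [gamma k.+1 = gamma k]. *)
Lemma gamma_gt0 k : 0 < gamma k.
Proof.
elim: k => [|k IH]; first by rewrite gamma0E invr_gt0.
have [//|g0] := ltP 0 (gamma k.+1).
have d0 : delta k.+1 = 0 by rewrite deltaE ler0_sqrtr// pmulr_rle0.
by move: g0; rewrite gammaS d0 subr0 mul1r leNgt IH.
Qed.

Lemma delta_gt0 k : 0 < delta k.
Proof. by rewrite deltaE sqrtr_gt0 mulr_gt0// gamma_gt0. Qed.

Lemma sqr_delta k : delta k ^+ 2 = eta * gamma k.
Proof. by rewrite deltaE sqr_sqrtr// ltW// mulr_gt0// gamma_gt0. Qed.

Lemma delta0 : delta 0%N = 1.
Proof. by rewrite deltaE gamma0E mulfV ?sqrtr1// gt_eqF. Qed.

Lemma sqr_deltaS k : delta k.+1 ^+ 2 = (1 - delta k.+1) * delta k ^+ 2.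
Proof. by rewrite !sqr_delta gammaS mulrCA. Qed.

Lemma delta_le1 k : delta k <= 1.
Proof.
case: k => [|k]; first by rewrite delta0.
have := sqr_deltaS k; have := delta_gt0 k; have := delta_gt0 k.+1.
by move: (delta k.+1) (delta k) => a b a0 b0 h; rewrite leNgt; apply/negP => a1; nra.
Qed.

Lemma delta_leS k : delta k.+1 <= delta k.
Proof.
have := sqr_deltaS k; have := delta_gt0 k; have := delta_gt0 k.+1.
by move: (delta k.+1) (delta k) => a b a0 b0 h; rewrite leNgt; apply/negP => ab; nra.
Qed.

Lemma delta_antitone m n : (m <= n)%N -> delta n <= delta m.
Proof.
by move=> /subnK <-; elim: (n - m)%N => //= k; apply: le_trans; exact: delta_leS.
Qed.

Lemma delta_inv_ge k : k.+2%:R / 2 <= (delta k)^-1.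
Proof.
elim: k => [|k IH]; first by rewrite delta0 invr1 divff.
have := delta_gt0 k; have := delta_gt0 k.+1; have := sqr_deltaS k.
set a := delta k.+1; set b := delta k => h a0 b0.
have hab : a^-1 * (a^-1 - 1) = (b^-1) ^+ 2.
  have an0 : a != 0 by rewrite gt_eqF.
  have bn0 : b != 0 by rewrite gt_eqF.
  have -> : a^-1 * (a^-1 - 1) = (1 - a) / a ^+ 2 by field.
  have -> : 1 - a = a ^+ 2 / b ^+ 2 by rewrite h; field.
  by field; rewrite an0 bn0.
have b1 : 0 < b^-1 by rewrite invr_gt0.
have a1 : 0 < a^-1 by rewrite invr_gt0.
rewrite -natr1 mulrDl; apply: (@le_trans _ _ (b^-1 + 2^-1)).
  by rewrite mul1r lerD2r.
move: (a^-1) (b^-1) a1 b1 hab => A B A0 B0 hAB.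
rewrite leNgt; apply/negP => hlt.
(* With [A] and [B] the new and old [1 / delta], the recursion reads
   [(A - 1/2) ^+ 2 = B ^+ 2 + 1/4]. If [A < B + 1/2], the second factor is negative, so [A < 1] and
   [A * (A - 1)] is negative, unlike [B ^+ 2]. *)
have e1 : (B + 2^-1 - A) * (B + A - 2^-1) = - 4^-1.
  by rewrite [LHS](_ : _ = B ^+ 2 - A * (A - 1) - 4^-1); [lra | field].
have e2 : B + A - 2^-1 < 0.
  rewrite -(pmulr_rlt0 _ (_ : 0 < B + 2^-1 - A)); last by lra.
  by rewrite e1 oppr_lt0 invr_gt0.
by have := mulr_gt0 A0 (_ : 0 < 1 - A); have := sqr_ge0 B; lra.
Qed.

(** This is the FISTA momentum [(t_k - 1) / t_{k+1}] with [t = 1 / delta]; the recursion gives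
    [a * (a + b ^+ 2) = b ^+ 2] for [a = delta k.+1], [b = delta k]. *)
Lemma extrapolationE k :
  extrapolation (fun=> eta) delta k = delta k.+1 * (1 - delta k) / delta k.
Proof.
rewrite /extrapolation.
have := delta_gt0 k; have := delta_gt0 k.+1; have := sqr_deltaS k.
move: (delta k.+1) (delta k) => a b h a0 b0.
have ab : 0 < a + b ^+ 2 by rewrite addr_gt0// exprn_gt0.
rewrite -mulrDr invfM [LHS]mulrC -!mulrA; apply: (@mulfI _ (a + b ^+ 2)).
  by rewrite gt_eqF.
have e : a * (a + b ^+ 2) = b ^+ 2 by move: h; lra.
apply: (@mulfI _ b); first by rewrite gt_eqF.
rewrite [RHS](_ : _ = (1 - b) * (a * (a + b ^+ 2))); last by field; rewrite gt_eqF.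
rewrite e; field; rewrite ?gt_eqF//.
Qed.

End StepSizes.

(** Lets the preliminary step, started at a deterministic point, be treated like the others: a mean
    is a conditional expectation given the trivial sigma-algebra. *)
Lemma sigma_algebra_trivial (T : Type) : sigma_algebra setT [set set0; [set: T]].
Proof.
split; first by left.
  by move=> A [->|->]; [right; rewrite setD0 | left; rewrite setDv].
move=> A hA; have [[k Ak]|nA] := pselect (exists k, A k = setT).
  by right; apply/seteqP; split=> // w _; exists k => //; rewrite Ak.
left; rewrite bigcup0// => k _; have [//|Ak] := hA k.
by case: nA; exists k.
Qed.

(** * Expectation of the noise of one step *)

Section StochasticStep.
Context {d : measure_display} {T : measurableType d} {R : realType} {p : nat}.
Variable P : probability T R.
Implicit Types X Y : T -> 'rV[R]_p.

Lemma mean_sq_errorC X Y : mean_sq_error P X Y = mean_sq_error P Y X.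
Proof.
rewrite /mean_sq_error; congr expectation.
by apply/funext => w; rewrite -enormN opprB.
Qed.

Lemma mean_sq_error_integrable X Y (c : R) :
  vec_measurable_wrt (@measurable d T) X -> vec_measurable_wrt (@measurable d T) Y ->
  (mean_sq_error P X Y <= c%:E)%E -> sq_integrable P (fun w => X w - Y w).
Proof.
move=> mX mY; rewrite /mean_sq_error unlock => hc.
have mXY : vec_measurable_wrt (@measurable d T) (fun w => X w - Y w).
  by apply: vec_measurable_wrtB => //; exact: sigma_algebra_measurable.
split=> //; apply/integrableP; split.
  by apply/measurable_EFinP; exact: measurable_sqr_enorm.
under eq_integral do rewrite /= ger0_norm ?sqr_ge0//.
exact: le_lt_trans hc (ltry _).
Qed.

Lemma cond_expectation_center (G : set (set T)) X Y :
  G `<=` @measurable d T -> is_cond_expectation P G X Y ->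
  (forall i, P.-integrable setT (fun w => ((Y w - X w) ord0 i)%:E)) /\
  (forall i A, G A -> (\int[P]_(w in A) ((Y w - X w) ord0 i)%:E = 0)%E).
Proof.
move=> Gm [_ h].
have E i : (fun w => ((Y w - X w) ord0 i)%:E) =
    (fun w => ((Y w ord0 i)%:E - (X w ord0 i)%:E)%E).
  by apply/funext => w; rewrite !mxE EFinB.
split=> [i|i A GA]; have [iX iY eXY] := h i.
  by rewrite E; exact: integrableB.
have iXA := integrableS measurableT (Gm _ GA) (@subsetT _ A) iX.
have iYA := integrableS measurableT (Gm _ GA) (@subsetT _ A) iY.
rewrite E integralB//; [|exact: Gm].
by rewrite eXY// subee// integrable_fin_num//; exact: Gm.
Qed.

Context {L eta sigma : R} {f : 'rV[R]_p -> R} {psi : 'rV[R]_p -> \bar R}.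
Hypothesis f_smooth : smooth L f.
Hypothesis psi_proper : proper_function psi.
Hypothesis psi_convex : econvex_function psi.
Hypothesis psi_lsc : lower_semicontinuous psi.
Hypothesis eta0 : 0 < eta.

Let prox1 u v : enorm (prox psi eta u - prox psi eta v) <= 1 * enorm (u - v).
Proof. by rewrite mul1r; exact: prox_nonexpansive. Qed.

Lemma step_noise_integral (G : set (set T)) (y g z : T -> 'rV[R]_p) :
  sigma_algebra setT G -> G `<=` @measurable d T ->
  vec_measurable_wrt G y -> sq_integrable P y ->
  vec_measurable_wrt G z -> sq_integrable P z ->
  vec_measurable_wrt (@measurable d T) g ->
  is_cond_expectation P G g (fun w => grad f (y w)) ->
  (mean_sq_error P (fun w => grad f (y w)) g <= (sigma ^+ 2)%:E)%E ->
  P.-integrable setT (EFin \o (fun w => step_noise eta f psi (y w) (g w) (z w))) /\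
  (\int[P]_w (step_noise eta f psi (y w) (g w) (z w))%:E <= (eta * sigma ^+ 2)%:E)%E.
Proof.
move=> sG Gm Gy iy Gz iz mg ce ms.
have [iEi E0] := cond_expectation_center Gm ce.
have mG : vec_measurable_wrt G (fun w => grad f (y w)).
  exact: (vec_measurable_wrt_lipschitz sG f_smooth.2).
have iE := mean_sq_error_integrable (vec_measurable_wrtS Gm mG) mg ms.
have ig : sq_integrable P (fun w => grad f (y w)).
  exact: (sq_integrable_lipschitz f_smooth.2).
(* Built from [y] and [z] alone, hence [G]-measurable and orthogonal to the gradient error; only the
   variance term of [step_noise] survives. *)
pose H w := prox psi eta (y w - eta *: grad f (y w)) - z w.
have GH : vec_measurable_wrt G H.
  apply: (vec_measurable_wrtB sG) => //.
  apply: (vec_measurable_wrt_lipschitz sG prox1).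
  by apply: (vec_measurable_wrtB sG) => //; exact: (vec_measurable_wrtZ sG).
have iH : sq_integrable P H.
  apply: sq_integrableB => //.
  apply: (sq_integrable_lipschitz prox1).
  by apply: sq_integrableB => //; exact: sq_integrableZ.
have i1 := sq_integrable_dotp iE iH.
have i2 := rintegrableZ eta iE.2.
split; first exact: rintegrableD.
rewrite /step_noise.
under eq_integral do rewrite EFinD.
rewrite integralD//= (integral_dotp_eq0 sG Gm iE iH GH iEi E0) add0e.
under eq_integral do rewrite EFinM.
rewrite integralZl//; last exact: iE.2.
rewrite EFinM; apply: lee_wpmul2l; first by rewrite lee_fin ltW.
by move: ms; rewrite /mean_sq_error unlock.
Qed.

End StochasticStep.

(** * Convergence rate *)

(** Index 0 is the preliminary step; its comparison point is [xs] itself, in agreement with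
    [delta 0 = 1]. *)
Definition noise (R : realType) (p : nat) (eta : R) (f : 'rV[R]_p -> R)
    (psi : 'rV[R]_p -> \bar R) (delta : nat -> R) (xs u0 h0 : 'rV[R]_p)
    (x y g : nat -> 'rV[R]_p) (n : nat) : R :=
  if n is k.+1 then
    step_noise eta f psi (y k) (g k.+1)
      (delta k.+1 *: xs + (1 - delta k.+1) *: x k)
  else step_noise eta f psi u0 h0 xs.

Section Lyapunov.
Context {R : realType} {p : nat} {L eta : R} {f : 'rV[R]_p -> R}
  {psi : 'rV[R]_p -> \bar R}.
Hypothesis f_convex : convex_function setT f.
Hypothesis f_smooth : smooth L f.
Hypothesis psi_proper : proper_function psi.
Hypothesis psi_convex : econvex_function psi.
Hypothesis psi_lsc : lower_semicontinuous psi.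
Hypothesis eta0 : 0 < eta.
Hypothesis etaL : eta <= L^-1.
Context {gamma delta : nat -> R}.
Hypothesis deltaE : forall k, delta k = Num.sqrt (eta * gamma k).
Hypothesis gammaS : forall k, gamma k.+1 = (1 - delta k.+1) * gamma k.
Hypothesis gamma0E : gamma 0%N = eta^-1.
Context {xs u0 h0 : 'rV[R]_p} {x y g : nat -> 'rV[R]_p}.
Hypothesis xs_dom : (psi xs < +oo)%E.
Hypothesis x0E : x 0%N = prox psi eta (u0 - eta *: h0).
Hypothesis y0E : y 0%N = x 0%N.
Hypothesis xSE : forall k, x k.+1 = prox psi eta (y k - eta *: g k.+1).
Hypothesis ySE : forall k,
  y k.+1 = x k.+1 + extrapolation (fun=> eta) delta k.+1 *: (x k.+1 - x k).

(** Solution of [x k = (1 - delta k) *: x k.-1 + delta k *: v k]. At [k = 0] the predecessor is 0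
    again, so [v 0 = x 0]. *)
Let v k := x k + ((1 - delta k) / delta k) *: (x k - x k.-1).

Let dn0 k : delta k != 0.
Proof. by rewrite gt_eqF// (delta_gt0 eta0 deltaE gammaS gamma0E). Qed.

Lemma iterate_dom k : (psi (x k) < +oo)%E.
Proof. by case: k => [|k]; rewrite ?x0E ?xSE; exact: prox_dom. Qed.

Lemma accelerated_lyapunov n :
  (robj f psi (x n) - robj f psi xs) / delta n ^+ 2
  + (2 * eta)^-1 * enorm (xs - v n) ^+ 2 <=
  (2 * eta)^-1 * enorm (xs - u0) ^+ 2
  + \sum_(k < n.+1) noise eta f psi delta xs u0 h0 x y g k / delta k ^+ 2.
Proof.
elim: n => [|n IH].
  rewrite big_ord1 /= (delta0 eta0 deltaE gamma0E) expr1n !divr1 /v subrr scaler0 addr0.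
  have := prox_grad_step f_convex f_smooth psi_proper psi_convex psi_lsc eta0 etaL
    u0 h0 xs_dom.
  by rewrite -x0E; lra.
have a0 := delta_gt0 eta0 deltaE gammaS gamma0E n.+1.
have a1 := delta_le1 eta0 deltaE gammaS gamma0E n.+1.
(* The momentum coefficient is exactly the one placing [y n] on the line from [x n] to [v n], so the
   distance term of one step is the starting term of the next. *)
have yE : y n = (1 - delta n.+1) *: x n + delta n.+1 *: v n.
  rewrite /v; case: n {IH a0 a1} => [|n].
    by rewrite y0E subrr scaler0 addr0 -scalerDl subrK scale1r.
  rewrite ySE (extrapolationE eta0 deltaE gammaS gamma0E).
  by apply/rowP => i; rewrite !mxE; field; exact: dn0.
have xE : x n.+1 = (1 - delta n.+1) *: x n + delta n.+1 *: v n.+1.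
  by rewrite /v; apply/rowP => i; rewrite !mxE; field; exact: dn0.
have := accelerated_step (g := g n.+1) f_convex f_smooth psi_proper psi_convex
  psi_lsc eta0 etaL (ltW a0) a1 xs_dom (iterate_dom n) yE.
rewrite -xSE => /(_ _ xE) step.
have d2 := sqr_deltaS eta0 deltaE gammaS gamma0E n.
rewrite big_ord_recr /= addrA.
apply: (@le_trans _ _ ((robj f psi (x n) - robj f psi xs) / delta n ^+ 2
  + (2 * eta)^-1 * enorm (xs - v n) ^+ 2
  + noise eta f psi delta xs u0 h0 x y g n.+1 / delta n.+1 ^+ 2)); last by rewrite lerD2r.
have A0 : 0 < delta n.+1 ^+ 2 by rewrite exprn_gt0.
rewrite -(ler_pM2l A0) !mulrDr.
have cancel c : delta n.+1 ^+ 2 * (c / delta n.+1 ^+ 2) = c.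
  by rewrite mulrC divfK// gt_eqF.
(* The step-size recursion turns the contraction factor into the previous weight, which makes the
   sum telescope. *)
have cancel' c : delta n.+1 ^+ 2 * (c / delta n ^+ 2) = (1 - delta n.+1) * c.
  by rewrite d2; field; exact: dn0.
by rewrite !cancel cancel'.
Qed.

End Lyapunov.

Lemma rate_bound (R : realType) (eta sigma D : R) (gamma delta : nat -> R) (K : nat) :
  0 < eta ->
  (forall k, delta k = Num.sqrt (eta * gamma k)) ->
  (forall k, gamma k.+1 = (1 - delta k.+1) * gamma k) ->
  gamma 0%N = eta^-1 ->
  delta K ^+ 2 * ((2 * eta)^-1 * D ^+ 2
    + \sum_(k < K.+1) eta * sigma ^+ 2 / delta k ^+ 2) <=
  2 * D ^+ 2 / ((1 + K%:R) ^+ 2 * eta) + sigma ^+ 2 * eta * (K%:R + 1).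
Proof.
move=> eta0 deltaE gammaS gamma0E.
have d0 k := delta_gt0 eta0 deltaE gammaS gamma0E k.
rewrite mulrDr; apply: lerD.
  have K0 : 0 < 1 + K%:R :> R by rewrite ltr_wpDr.
  (* [delta_inv_ge] gives [2 / (K + 2)], weakened to the denominator of the stated rate. *)
  have h : delta K <= 2 / (1 + K%:R).
    have := delta_inv_ge eta0 deltaE gammaS gamma0E K.
    rewrite -[_ / 2]invrK lef_pV2 ?posrE ?invr_gt0 ?divr_gt0 ?d0 ?ltr0n// => h.
    apply: le_trans h _; rewrite invf_div ler_pM2l// lef_pV2 ?posrE// ?ltr0n//.
    by rewrite addrC natr1 ler_nat.
  have {}h : delta K ^+ 2 <= (2 / (1 + K%:R)) ^+ 2.
    by apply: lerXn2r h; rewrite nnegrE ltW// divr_gt0.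
  apply: (@le_trans _ _ ((2 / (1 + K%:R)) ^+ 2 * ((2 * eta)^-1 * D ^+ 2))).
    by rewrite ler_wpM2r// mulr_ge0 ?sqr_ge0// invr_ge0 ltW// mulr_gt0.
  by rewrite le_eqVlt; apply/orP; left; apply/eqP; field; rewrite !gt_eqF.
rewrite mulr_sumr.
apply: (@le_trans _ _ (\sum_(k < K.+1) sigma ^+ 2 * eta)).
  apply: ler_sum => k _.
  (* As [delta] is nonincreasing, each ratio is at most 1, and there are [K + 1] terms including the
     preliminary step. *)
  rewrite [leLHS](_ : _ = sigma ^+ 2 * eta * (delta K ^+ 2 / delta k ^+ 2)); last by ring.
  have se : 0 <= sigma ^+ 2 * eta by apply: mulr_ge0; [exact: sqr_ge0 | exact: ltW].
  rewrite -[leRHS]mulr1 ler_wpM2l//.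
  rewrite ler_pdivrMr ?exprn_gt0// mul1r.
  apply: lerXn2r; rewrite ?nnegrE ?(ltW (d0 _))//.
  by apply: (delta_antitone eta0 deltaE gammaS gamma0E); rewrite -ltnS.
by rewrite sumr_const card_ord natr1 mulr_natr.
Qed.

(** Let [s] be the second argument of the minimum. Then [eta <= s] and [eta^-1 <= L + s^-1], and [s]
    balances the two noise contributions, each equal to [D * sigma * Num.sqrt (2 / (1 + K%:R))]. *)
Lemma tuned_bound (R : realType) (L eta sigma D : R) (K : nat) :
  0 < L -> 0 < eta -> 0 <= sigma -> 0 <= D -> eta = tuned_stepsize L D sigma K ->
  2 * D ^+ 2 / ((1 + K%:R) ^+ 2 * eta) + sigma ^+ 2 * eta * (K%:R + 1) <=
  2 * L * D ^+ 2 / (1 + K%:R) ^+ 2 + 2 * D * sigma * Num.sqrt (2 / (1 + K%:R)).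
Proof.
move=> L0 eta0 s0 D0.
have K0 : 0 < 1 + K%:R :> R by rewrite ltr_wpDr.
have S0 : 0 < Num.sqrt (1 + K%:R : R) by rewrite sqrtr_gt0.
have SE : 1 + K%:R = Num.sqrt (1 + K%:R) ^+ 2 :> R by rewrite sqr_sqrtr// ltW.
rewrite /tuned_stepsize; have [->|sn0] := eqVneq sigma 0.
  move=> ->; rewrite expr0n /= !mul0r mulr0 mul0r !addr0.
  by rewrite le_eqVlt; apply/orP; left; apply/eqP; field; rewrite !gt_eqF.
have {sn0}s0 : 0 < sigma by rewrite lt_def sn0.
rewrite (_ : K.+1%:R `^ (3 / 2) = Num.sqrt (1 + K%:R) ^+ 3); last first.
  by rewrite mulrC powRrM powR12_sqrt// powR_mulrn ?sqrtr_ge0// -natr1 addrC.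
rewrite (_ : Num.sqrt (2 * D ^+ 2 / sigma ^+ 2) = Num.sqrt 2 * D / sigma); last first.
  by rewrite -mulrA -expr_div_n sqrtrM// sqrtr_sqr ger0_norm ?mulrA// divr_ge0// ltW.
rewrite (_ : Num.sqrt (2 / (1 + K%:R)) = Num.sqrt 2 / Num.sqrt (1 + K%:R)); last first.
  by rewrite sqrtrM// sqrtrV// ltW.
have r0 : 0 < Num.sqrt 2 :> R by rewrite sqrtr_gt0.
have r2 : Num.sqrt 2 ^+ 2 = 2 :> R by rewrite sqr_sqrtr.
move: (Num.sqrt 2) (Num.sqrt (1 + K%:R)) r0 r2 S0 SE => r q r0 r2 q0 SE.
rewrite [K%:R + 1]addrC SE.
set s := r * D / sigma / q ^+ 3 => etaE.
have es : eta <= s by rewrite etaE ge_min lexx orbT.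
have s_gt0 : 0 < s by exact: lt_le_trans es.
have D_gt0 : 0 < D.
  by rewrite lt_def D0 andbT; apply: contraTneq s_gt0 => E; rewrite /s E mulr0 !mul0r ltxx.
have einv : eta^-1 <= L + s^-1.
  rewrite etaE /Num.min; case: ifP => _; first by rewrite invrK lerDl invr_ge0 ltW.
  by rewrite lerDr ltW.
have t1 : 2 * D ^+ 2 / ((q ^+ 2) ^+ 2 * eta) <= 2 * D ^+ 2 / (q ^+ 2) ^+ 2 * (L + s^-1).
  rewrite invfM mulrA; apply: ler_wpM2l => //.
  by rewrite mulr_ge0 ?invr_ge0 ?sqr_ge0// mulr_ge0 ?sqr_ge0.
have t2 : sigma ^+ 2 * eta * q ^+ 2 <= sigma ^+ 2 * s * q ^+ 2.
  by rewrite ler_wpM2r ?sqr_ge0// ler_wpM2l ?sqr_ge0.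
apply: (le_trans (lerD t1 t2)).
(* Expanding the fraction by [r], the square root of 2, lets [r ^+ 2] be replaced by 2, so that both
   sides agree as rational expressions in [r]. *)
have -> : s^-1 = r * sigma * q ^+ 3 / (r ^+ 2 * D).
  by rewrite /s; field; rewrite !gt_eqF.
rewrite r2 /s le_eqVlt; apply/orP; left; apply/eqP.
by field; rewrite !gt_eqF.
Qed.

Theorem corollary15 (d : measure_display) (T : measurableType d) (R : realType)
    (P : probability T R) (p : nat)
    (L : R) (f : 'rV[R]_p -> R) (psi : 'rV[R]_p -> \bar R) (xstar : 'rV[R]_p)
    (hL : 0 < L)
    (hf_convex : convex_function setT f)
    (hf_smooth : smooth L f)
    (hpsi_proper : proper_function psi)
    (hpsi_convex : econvex_function psi)
    (hpsi_lsc : lower_semicontinuous psi)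
    (hxstar : argmin (objective f psi) xstar)
    (eta sigma : R)
    (heta : 0 < eta <= L^-1)
    (hsigma : 0 <= sigma)
    (x0 : 'rV[R]_p) (g0 x0' : T -> 'rV[R]_p)
    (F : nat -> set (set T))
    (hg0_meas : vec_measurable_wrt (F 0%N) g0)
    (hg0_mean : has_mean P g0 (grad f x0))
    (hg0_var :
      (mean_sq_error P g0 (fun _ => grad f x0) <= (sigma ^+ 2)%:E)%E)
    (hx0' : forall w, x0' w = prox psi eta (x0 - eta *: g0 w))
    (gamma delta : nat -> R) (g x y : nat -> T -> 'rV[R]_p)
    (hC : algorithm_C P L f psi (fun _ => eta) gamma delta F x0' g x y)
    (hgamma0 : gamma 0%N = eta^-1)
    (homega : forall k,
      (mean_sq_error P (fun w => grad f (y k w)) (g k.+1)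
        <= (sigma ^+ 2)%:E)%E)
    (K : nat) (hK : (1 <= K)%N) :
  (\int[P]_w (objective f psi (x K w) - objective f psi xstar)
    <= (2 * enorm (x0 - xstar) ^+ 2 / ((1 + K%:R) ^+ 2 * eta)
        + sigma ^+ 2 * eta * (K%:R + 1))%:E)%E
  /\
  (eta = tuned_stepsize L (enorm (x0 - xstar)) sigma K ->
   (\int[P]_w (objective f psi (x K w) - objective f psi xstar)
    <= (2 * L * enorm (x0 - xstar) ^+ 2 / (1 + K%:R) ^+ 2
        + 2 * enorm (x0 - xstar) * sigma * Num.sqrt (2 / (1 + K%:R)))%:E)%E).
Proof.
have [eta0 etaL] := andP heta.
case: hC => _ _ deltaE gammaS [sF Fm FS] adapted unbiased x0E y0E xSE ySE.
have xs_dom : (psi xstar < +oo)%E.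
  have [z zdom] := hpsi_proper.2.
  have := hxstar z; rewrite /objective (proper_fine hpsi_proper zdom) -EFinD => h.
  rewrite ltNge leye_eq; apply/negP => /eqP E; move: h.
  by rewrite E addey// leNgt ltry.
have objE u : (psi u < +oo)%E -> objective f psi u = (robj f psi u)%:E.
  by move=> udom; rewrite /objective (proper_fine hpsi_proper udom).
have dom k w : (psi (x k w) < +oo)%E.
  by case: k => [|k]; rewrite ?x0E ?hx0' ?xSE; exact: prox_dom.
pose N k w :=
  noise eta f psi delta xstar x0 (g0 w) (x ^~ w) (y ^~ w) (g ^~ w) k.
pose D := enorm (x0 - xstar).
have d0 k : 0 < delta k := delta_gt0 eta0 deltaE gammaS hgamma0 k.
have lyap n w : robj f psi (x n w) - robj f psi xstar <=
    delta n ^+ 2 * ((2 * eta)^-1 * D ^+ 2 + \sum_(k < n.+1) N k w / delta k ^+ 2).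
  have := accelerated_lyapunov (x := x ^~ w) (y := y ^~ w) (g := g ^~ w)
    (u0 := x0) (h0 := g0 w) hf_convex hf_smooth hpsi_proper hpsi_convex hpsi_lsc eta0 etaL deltaE gammaS
    hgamma0 xs_dom _ _ (fun k => xSE k w) (fun k => ySE k w) n.
  rewrite x0E y0E hx0' => /(_ erefl erefl).
  rewrite -/(N _ w) -/(enorm (x0 - xstar)) -(enormN (xstar - x0)) opprB -/D => h.
  rewrite -ler_pdivrMl ?exprn_gt0// mulrC; apply: le_trans h.
  by rewrite lerDl mulr_ge0 ?sqr_ge0// invr_ge0 ltW// mulr_gt0.
have prox1 u v : enorm (prox psi eta u - prox psi eta v) <= 1 * enorm (u - v).
  by rewrite mul1r; exact: prox_nonexpansive.
have mg0 := vec_measurable_wrtS (Fm 0%N) hg0_meas.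
have mg k := vec_measurable_wrtS (Fm k.+1) (adapted k).
have ie0 : sq_integrable P (fun w => g0 w - grad f x0).
  apply: mean_sq_error_integrable hg0_var => //.
  exact: vec_measurable_wrt_cst (@sigma_algebra_measurable _ T) _.
have ig0 : sq_integrable P g0.
  have -> : g0 = (fun w => (g0 w - grad f x0) + grad f x0).
    by apply/funext => t; rewrite subrK.
  by apply: sq_integrableD => //; exact: sq_integrable_cst.
(* Integrability propagates by induction: [grad f (y k)] is square integrable by Lipschitz
   continuity, the variance bound passes this on to [g k.+1], and the proximal map preserves it. *)
have reg k : [/\ vec_measurable_wrt (F k) (x k), sq_integrable P (x k),
    vec_measurable_wrt (F k) (y k) & sq_integrable P (y k)].
  elim: k => [|k [mx ix my iy]].
    have -> : y 0%N = x 0%N by apply/funext => t; rewrite x0E y0E.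
    have -> : x 0%N = prox psi eta \o (fun w => x0 - eta *: g0 w).
      by apply/funext => t; rewrite x0E hx0'.
    have m0 : vec_measurable_wrt (F 0%N) (prox psi eta \o (fun w => x0 - eta *: g0 w)).
      apply: (vec_measurable_wrt_lipschitz (sF 0%N) prox1).
      apply: (vec_measurable_wrtB (sF 0%N)); first exact: vec_measurable_wrt_cst.
      exact: vec_measurable_wrtZ.
    have i0 : sq_integrable P (prox psi eta \o (fun w => x0 - eta *: g0 w)).
      apply: (sq_integrable_lipschitz prox1).
      by apply: sq_integrableB; [exact: sq_integrable_cst | exact: sq_integrableZ].
    by split.
  have mx' := vec_measurable_wrtS (FS k) mx.
  have my' := vec_measurable_wrtS (FS k) my.
  have iG : sq_integrable P (fun w => grad f (y k w)).
    exact: (sq_integrable_lipschitz hf_smooth.2).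
  have iE := mean_sq_error_integrable iG.1 (mg k) (homega k).
  have ig : sq_integrable P (g k.+1).
    have -> : g k.+1 = (fun w => grad f (y k w) - (grad f (y k w) - g k.+1 w)).
      by apply/funext => t; rewrite opprB addrC subrK.
    exact: sq_integrableB.
  have xE : x k.+1 = prox psi eta \o (fun w => y k w - eta *: g k.+1 w).
    by apply/funext => t; rewrite xSE.
  have mxS : vec_measurable_wrt (F k.+1) (x k.+1).
    rewrite xE; apply: (vec_measurable_wrt_lipschitz (sF _) prox1).
    by apply: (vec_measurable_wrtB (sF _)) => //; exact: (vec_measurable_wrtZ (sF _)).
  have ixS : sq_integrable P (x k.+1).
    rewrite xE; apply: (sq_integrable_lipschitz prox1).
    by apply: sq_integrableB => //; exact: sq_integrableZ.
  have yE : y k.+1 = (fun w => x k.+1 w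
      + extrapolation (fun=> eta) delta k.+1 *: (x k.+1 w - x k w)).
    by apply/funext => t; rewrite ySE.
  split=> //; rewrite yE.
    apply: (vec_measurable_wrtD (sF _)) => //; apply: (vec_measurable_wrtZ (sF _)).
    exact: (vec_measurable_wrtB (sF _)).
  by apply: sq_integrableD => //; apply: sq_integrableZ; exact: sq_integrableB.
have noise_int k : P.-integrable setT (EFin \o N k) /\
    (\int[P]_w (N k w)%:E <= (eta * sigma ^+ 2)%:E)%E.
  case: k => [|k].
    (* Since [g0] is itself [F 0]-measurable, the preliminary step is conditioned on the trivial
       sigma-algebra. *)
    apply: (step_noise_integral hf_smooth hpsi_proper hpsi_convex hpsi_lsc eta0
      (@sigma_algebra_trivial T) (y := fun=> x0) (z := fun=> xstar)) => //.
    - by move=> A [->|->]; [exact: measurable0 | exact: measurableT].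
    - exact: (vec_measurable_wrt_cst (@sigma_algebra_trivial T)).
    - exact: sq_integrable_cst.
    - exact: (vec_measurable_wrt_cst (@sigma_algebra_trivial T)).
    - exact: sq_integrable_cst.
    - split; first exact: (vec_measurable_wrt_cst (@sigma_algebra_trivial T)).
      move=> i; have [ig0i eg0i] := hg0_mean i; split=> //.
        exact: rintegrable_cst.
      move=> A [->|->]; first by rewrite !integral_set0.
      move: eg0i; rewrite unlock => ->; rewrite integral_cst//=.
      by rewrite probability_setT mule1.
    - by rewrite mean_sq_errorC.
  have [mx ix my iy] := reg k.
  apply: (step_noise_integral hf_smooth hpsi_proper hpsi_convex hpsi_lsc eta0 (sF k)
    (y := y k) (g := g k.+1)
    (z := fun w => delta k.+1 *: xstar + (1 - delta k.+1) *: x k w)) => //.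
  - apply: (vec_measurable_wrtD (sF k)); first exact: vec_measurable_wrt_cst.
    exact: vec_measurable_wrtZ.
  - by apply: sq_integrableD; [exact: sq_integrable_cst | exact: sq_integrableZ].
have main : (\int[P]_w (objective f psi (x K w) - objective f psi xstar)
    <= (2 * D ^+ 2 / ((1 + K%:R) ^+ 2 * eta) + sigma ^+ 2 * eta * (K%:R + 1))%:E)%E.
  pose U w := (2 * eta)^-1 * D ^+ 2 + \sum_(k < K.+1) (delta k ^+ 2)^-1 * N k w.
  have iS : P.-integrable setT
      (fun w => (\sum_(k < K.+1) ((delta k ^+ 2)^-1)%:E * (N k w)%:E)%E).
    apply: integrable_sum => // k _.
    by apply: integrableZl => //; exact: (noise_int k).1.
  have UE : EFin \o U = (fun w => ((2 * eta)^-1 * D ^+ 2)%:E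
      + \sum_(k < K.+1) ((delta k ^+ 2)^-1)%:E * (N k w)%:E)%E.
    by apply/funext => t; rewrite /= EFinD -sumEFin.
  have iU : P.-integrable setT (EFin \o U).
    by rewrite UE; apply: integrableD => //; exact: rintegrable_cst.
  have intU : (\int[P]_w (U w)%:E <= ((2 * eta)^-1 * D ^+ 2
      + \sum_(k < K.+1) eta * sigma ^+ 2 / delta k ^+ 2)%:E)%E.
    rewrite -[X in (\int[P]_w X w <= _)%E]/(EFin \o U) UE.
    rewrite integralD//; last exact: rintegrable_cst.
    rewrite integral_cst//= probability_setT mule1 EFinD leeD2l// integral_sum//; last first.
      by move=> k; apply: integrableZl => //; exact: (noise_int k).1.
    rewrite -sumEFin; apply: lee_sum => k _.
    rewrite integralZl//; last exact: (noise_int k).1.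
    rewrite mulrC EFinM; apply: lee_wpmul2l; last exact: (noise_int k).2.
    by rewrite lee_fin invr_ge0 sqr_ge0.
  have mobj : measurable_fun setT
      (fun w => objective f psi (x K w) - objective f psi xstar)%E.
    have [mx _ _ _] := reg K.
    have mxT := vec_measurable_wrtS (Fm K) mx.
    have cf : continuous f by move=> u; exact/differentiable_continuous/hf_smooth.1.
    apply: emeasurable_funB => //; apply: emeasurable_funD.
      apply/measurable_EFinP; apply: (measurable_wrt_measurable_fun (Fm K)).
      exact: (measurable_wrt_continuous (sF K) mx cf).
    move=> _ B mB; rewrite setTI; apply: (Fm K).
    have := measurable_wrt_lsc (sF K) mx hpsi_lsc measurableT mB.
    by rewrite setTI measurable_g_measurableTypeE.
  apply: (@le_trans _ _ (\int[P]_w ((delta K ^+ 2)%:E * (U w)%:E))%E).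
    (* Minimality of [xstar] makes the gap nonnegative, so the pointwise Lyapunov bound integrates
       directly. *)
    apply: ge0_le_integral => //.
    - move=> w _; rewrite (objE _ (dom K w)) (objE _ xs_dom) -EFinB lee_fin subr_ge0.
      by have := hxstar (x K w); rewrite (objE _ (dom K w)) (objE _ xs_dom) lee_fin.
    - by apply: measurable_funeM; case/integrableP: iU.
    - move=> w _; rewrite (objE _ (dom K w)) (objE _ xs_dom) -EFinB -EFinM lee_fin /U.
      under eq_bigr do rewrite mulrC.
      exact: lyap.
  rewrite integralZl//; apply: (@le_trans _ _ ((delta K ^+ 2)%:E * ((2 * eta)^-1 * D ^+ 2
      + \sum_(k < K.+1) eta * sigma ^+ 2 / delta k ^+ 2)%:E)%E).
    by apply: lee_wpmul2l => //; rewrite lee_fin sqr_ge0.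
  by rewrite -EFinM lee_fin (rate_bound _ _ _ eta0 deltaE gammaS hgamma0).
split; first exact: main.
move=> etaE; apply: le_trans main _; rewrite lee_fin.
exact: (tuned_bound hL eta0 hsigma (enorm_ge0 _) etaE).
Qed.
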